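(* Let $\mathcal M=\mathbb R\times\mathcal N$ with structure $(\phi,\xi,\eta,g^L)$ be the Sasakian lift of a Kähler manifold $(\mathcal N,J,g)$ with Kähler form $\omega=d\tau$. Let $\overline{Ric}$ be the Ricci tensor of $g^L$. Then the tensor field $\bar\rho(\cdot,\cdot)=\overline{Ric}(\cdot,\phi\,\cdot)$ on $\mathcal M$ is a closed 2-form, and moreover $$\bar\rho=\pi_2^*\rho-2\pi_2^*\omega,$$ where $\rho(X,Y)=Ric(X,JY)$ is the Ricci form of $\mathcal N$ and $\pi_2:\mathcal M\to\mathcal N$ is the projection.
   Context: Conventions: $2\,d\theta(X,Y)=X\theta(Y)-Y\theta(X)-\theta([X,Y])$ for a 1-form $\theta$. On a Kähler manifold $(\mathcal N,J,g)$, $\dim\mathcal N=2n$, the Kähler form is $\omega(X,Y)=g(X,JY)$; it is assumed that there is a global 1-form $\tau$ with $\omega=d\tau$. Sasakian lift: $\mathcal M=\mathbb R\times\mathcal N$ with projection $\pi_2:\mathcal M\to\mathcal N$ and coordinate $t$ on $\mathbb R$; $\xi=\partial_t$, $\eta=dt+\pi_2^*\tau$. A vector field $X$ on $\mathcal N$ is lifted to $X^L=X-(\tau(X)\circ\pi_2)\,\xi$ on $\mathcal M$. The $(1,1)$-tensor $\phi$ and metric $g^L$ are determined by $\phi X^L=(JX)^L$, $\phi\xi=0$, $g^L=\eta\otimes\eta+\pi_2^*g$. *)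

(* Defs.v *)
From HB Require Import structures.
From mathcomp Require Import all_boot all_order all_algebra.
From mathcomp Require Import all_classical all_reals all_analysis.
From mathcomp Require Import ring.

Set Implicit Arguments.
Unset Strict Implicit.
Unset Printing Implicit Defensive.

Import Order.TTheory GRing.Theory Num.Theory.
Import numFieldNormedType.Exports.

Local Open Scope classical_set_scope.
Local Open Scope ring_scope.

(* Points and tangent vectors of R^m are row vectors, covectors are column
    vectors, a bilinear form [T] is evaluated as [u *m T *m v^T] and an
    endomorphism [A] acts by [v |-> v *m A].  The derivative [X f] of a
    function along a vector field is ['D_(X x) f x]. *)

Section Calculus.
Context {R : realType}.

Definition iter_derive {V W : normedModType R} (vs : seq V) (f : V -> W) :
    V -> W :=
  foldr (fun v h => 'D_v h) f vs.

(* [f] is C^oo on the open set [U]: all the iterated directional derivatives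
   are Frechet differentiable, hence continuous, on [U]. *)
Definition smooth_on {V W : normedModType R} (U : set V) (f : V -> W) : Prop :=
  forall vs x, U x -> differentiable (iter_derive vs f) x.

Definition pairing {m} (v : 'rV[R]_m) (a : 'cV[R]_m) : R := (v *m a) 0 0.

Definition bil {m} (T : 'M[R]_m) (u v : 'rV[R]_m) : R :=
  (u *m T *m v^T) 0 0.

Definition pull1 {m k} (F : 'rV[R]_m -> 'rV[R]_k) (theta : 'rV[R]_k -> 'cV[R]_k)
    (x : 'rV[R]_m) : 'cV[R]_m :=
  'J F x *m theta (F x).

Definition pull2 {m k} (F : 'rV[R]_m -> 'rV[R]_k) (T : 'rV[R]_k -> 'M[R]_k)
    (x : 'rV[R]_m) : 'M[R]_m :=
  'J F x *m T (F x) *m ('J F x)^T.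

Section Fields.
Context {m : nat}.
Implicit Types X Y Z : 'rV[R]_m -> 'rV[R]_m.

Definition lie_bracket X Y (x : 'rV[R]_m) : 'rV[R]_m :=
  'D_(X x) Y x - 'D_(Y x) X x.

(* The factors 1/2 and 1/3 are those of the convention in which d of a k-form
   carries 1/(k+1). *)
Definition ext_d1 (theta : 'rV[R]_m -> 'cV[R]_m) X Y (x : 'rV[R]_m) : R :=
  2^-1 * ('D_(X x) (fun y => pairing (Y y) (theta y)) x
          - 'D_(Y x) (fun y => pairing (X y) (theta y)) x
          - pairing (lie_bracket X Y x) (theta x)).

Definition ext_d2 (B : 'rV[R]_m -> 'M[R]_m) X Y Z (x : 'rV[R]_m) : R :=
  3^-1 * ('D_(X x) (fun y => bil (B y) (Y y) (Z y)) x
          + 'D_(Y x) (fun y => bil (B y) (Z y) (X y)) x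
          + 'D_(Z x) (fun y => bil (B y) (X y) (Y y)) x
          - bil (B x) (lie_bracket X Y x) (Z x)
          - bil (B x) (lie_bracket Y Z x) (X x)
          - bil (B x) (lie_bracket Z X x) (Y x)).

Section LeviCivita.
Variable G : 'rV[R]_m -> 'M[R]_m.

(* Christoffel symbols of the first kind, contracted with u, v, w:
   2 Gamma(u, v; w) = (D_u g)(v, w) + (D_v g)(u, w) - (D_w g)(u, v). *)
Definition christoffel1 (x u v w : 'rV[R]_m) : R :=
  2^-1 * (bil ('D_u G x) v w + bil ('D_v G x) u w - bil ('D_w G x) u v).

Definition christoffel (x u v : 'rV[R]_m) : 'rV[R]_m :=
  (\row_l christoffel1 x u v (delta_mx 0 l)) *m invmx (G x).

Definition nabla X Y (x : 'rV[R]_m) : 'rV[R]_m :=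
  'D_(X x) Y x + christoffel x (X x) (Y x).

Definition curvature X Y Z (x : 'rV[R]_m) : 'rV[R]_m :=
  nabla X (nabla Y Z) x - nabla Y (nabla X Z) x - nabla (lie_bracket X Y) Z x.

(* Ric(u, v) is the trace of w |-> R(w, u) v; the curvature being tensorial,
   it is computed on the coordinate vector fields. *)
Definition ricci (x : 'rV[R]_m) : 'M[R]_m :=
  \matrix_(a, b) \sum_(k < m)
    curvature (cst (delta_mx 0 k)) (cst (delta_mx 0 a)) (cst (delta_mx 0 b))
      x 0 k.

End LeviCivita.
End Fields.
End Calculus.

Section LeviCivitaTheory.
Context {R : realType} {m : nat}.
Implicit Types (G : 'rV[R]_m -> 'M[R]_m) (X Y Z : 'rV[R]_m -> 'rV[R]_m).

Lemma bilE (T : 'M[R]_m) u v : bil T u v = \sum_i \sum_j u 0 i * T i j * v 0 j.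
Proof.
rewrite /bil mxE exchange_big /=; apply: eq_bigr => j _.
by rewrite !mxE mulr_suml.
Qed.

Lemma derivable_entry {p q} (M : 'rV[R]_m -> 'M[R]_(p, q)) x v i j :
  differentiable M x -> derivable (fun y => M y i j) x v.
Proof. by move=> dM; apply: (derivable_mxP M x v).1; exact: diff_derivable. Qed.

Lemma derive_entry {p q} (M : 'rV[R]_m -> 'M[R]_(p, q)) x v i j :
  differentiable M x -> 'D_v (fun y => M y i j) x = ('D_v M x) i j.
Proof. by move=> dM; rewrite derive_mx ?mxE //; exact: diff_derivable. Qed.

Lemma derive_bil G X Y (x v : 'rV[R]_m) :
  differentiable G x -> differentiable X x -> differentiable Y x ->
  'D_v (fun y => bil (G y) (X y) (Y y)) x =
  bil ('D_v G x) (X x) (Y x) + bil (G x) ('D_v X x) (Y x)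
  + bil (G x) (X x) ('D_v Y x).
Proof.
move=> dG dX dY.
have -> : (fun y => bil (G y) (X y) (Y y)) =
   \sum_i \sum_j ((fun y => X y 0 i) * (fun y => G y i j) * (fun y => Y y 0 j)).
  apply/funext => y; rewrite bilE fct_sumE; apply: eq_bigr => i _.
  by rewrite fct_sumE.
have dXG i j : derivable ((fun y => X y 0 i) * (fun y => G y i j)) x v.
  by apply: derivableM; exact: derivable_entry.
have dXGY i j :
  derivable ((fun y => X y 0 i) * (fun y => G y i j) * (fun y => Y y 0 j)) x v.
  by apply: derivableM => //; exact: derivable_entry.
rewrite derive_sum; last by move=> i; exact: derivable_sum.
rewrite !bilE -!big_split /=; apply: eq_bigr => i _.
rewrite derive_sum // -!big_split /=; apply: eq_bigr => j _.
rewrite deriveM //; last exact: derivable_entry.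
rewrite deriveM; [|exact: derivable_entry|exact: derivable_entry].
by rewrite !derive_entry // !fctE /GRing.scale /=; ring.
Qed.

Lemma derive_sym G U x w : open U -> U x -> differentiable G x ->
  (forall y, U y -> (G y)^T = G y) -> ('D_w G x)^T = 'D_w G x.
Proof.
move=> oU Ux dG sG; apply/matrixP => i j; rewrite mxE -!derive_entry //.
apply: near_eq_derive; near=> y.
by rewrite -[in LHS](sG y) ?mxE //; near: y; exact: open_nbhs_nbhs.
Unshelve. all: by end_near. Qed.

Lemma bil_sym (T : 'M[R]_m) u v : T^T = T -> bil T u v = bil T v u.
Proof.
by move=> sT; rewrite /bil -[LHS]trace_mx11 -mxtrace_tr !trmx_mul trmxK sT
  mulmxA trace_mx11.
Qed.

Lemma christoffel_lower G x u v w : G x \in unitmx -> differentiable G x ->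
  (G x)^T = G x ->
  bil (G x) (christoffel G x u v) w = christoffel1 G x u v w.
Proof.
move=> uG dG sG; rewrite /bil /christoffel mulmxKV // mxE.
rewrite /christoffel1.
have L (B : 'rV[R]_m -> R) : linear (B : _ -> R^o) ->
    \sum_l B (delta_mx 0 l) * w 0 l = B w.
  move=> lB; pose b : {linear 'rV[R]_m -> R^o} :=
    HB.pack B (GRing.isLinear.Build _ _ _ _ B lB).
  rewrite [in RHS](row_sum_delta w) -[B _]/(b _) linear_sum.
  by apply: eq_bigr => l _; rewrite linearZ /= mulrC.
under eq_bigr do rewrite !mxE.
rewrite (L (fun w => 2^-1 * (bil ('D_u G x) v w + bil ('D_v G x) u w
                             - bil ('D_w G x) u v))) //.
move=> a p q; rewrite !deriveE // linearP /=.
rewrite /bil !linearP /= !(mulmxDr, mulmxDl, =^~ scalemxAr, =^~ scalemxAl) !mxE.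
by rewrite /GRing.scale /=; ring.
Qed.

Lemma nabla_torsion_free G U X Y x : open U -> U x -> differentiable G x ->
  (forall y, U y -> (G y)^T = G y) ->
  nabla G X Y x - nabla G Y X x = lie_bracket X Y x.
Proof.
move=> oU Ux dG sG; rewrite /nabla /lie_bracket.
suff -> : christoffel G x (X x) (Y x) = christoffel G x (Y x) (X x).
  by rewrite opprD addrACA subrr addr0.
rewrite /christoffel; congr (_ *m _); apply/rowP => l; rewrite !mxE.
rewrite /christoffel1 (bil_sym (X x) (Y x)); last exact: derive_sym sG.
by rewrite [X in X - _]addrC.
Qed.

Lemma nabla_metric G U X Y Z x : open U -> U x -> differentiable G x ->
  (forall y, U y -> (G y)^T = G y) -> G x \in unitmx ->
  differentiable Y x -> differentiable Z x ->
  'D_(X x) (fun y => bil (G y) (Y y) (Z y)) x =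
  bil (G x) (nabla G X Y x) (Z x) + bil (G x) (Y x) (nabla G X Z x).
Proof.
move=> oU Ux dG sG uG dY dZ; rewrite derive_bil //.
have bD u v w : bil (G x) (u + v) w = bil (G x) u w + bil (G x) v w.
  by rewrite /bil !mulmxDl mxE.
rewrite [bil _ (Y x) (nabla _ _ _ _)]bil_sym ?sG // /nabla !bD.
rewrite !christoffel_lower ?sG // [bil _ ('D_ _ Z _) _]bil_sym ?sG //.
rewrite /christoffel1 (bil_sym (Z x) (Y x) (derive_sym _ oU Ux dG sG)).
by field.
Qed.
End LeviCivitaTheory.

Section SmoothMaps.
Context {R : realType}.

Lemma near_eq_differentiable {V W : normedModType R} (f g : V -> W) (a : V) :
  (\near a, f a = g a) -> differentiable f a -> differentiable g a.
Proof.
move=> fg df.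
have fga : f a = g a by exact: nbhs_singleton fg.
have dfc : continuous ('d f a) by exact: diff_continuous.
have H : g \o shift a = cst (g a) + 'd f a +o_ 0 id.
  apply/eqaddoP => e e0.
  have /eqaddoP/(_ e e0) := diff_locally df.
  have fg0 : \forall h \near 0, f (h + a) = g (h + a).
    by move: fg; rewrite (near_shift 0 a) /= subr0.
  move=> fe; near=> h.
  have -> : (g \o shift a - (cst (g a) + 'd f a)) h =
            (f \o shift a - (cst (f a) + 'd f a)) h.
    by rewrite !fctE /= /cst fga (near fg0 h).
  by near: h.
apply/diff_locallyP.
by rewrite (diff_unique dfc H).
Unshelve. all: by end_near. Qed.

Lemma iter_derive_linear {V W : normedModType R} (L : {linear V -> W})
    (vs : seq V) : continuous L ->
  iter_derive vs L = L \/ exists c, iter_derive vs L = cst c.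
Proof.
move=> Lc; elim: vs => [|v vs [/= ->|[c /= ->]]]; first by left.
  right; exists (L v); apply/funext => x.
  by rewrite deriveE ?diff_lin //; exact: linear_differentiable.
by right; exists 0; apply/funext => x; rewrite derive_cst.
Qed.

Lemma smooth_on_linear {V W : normedModType R} (L : {linear V -> W}) U :
  continuous L -> smooth_on U L.
Proof.
move=> Lc vs x _; case: (iter_derive_linear vs Lc) => [->|[c ->]] //.
exact: linear_differentiable.
Qed.

Lemma smooth_on_eq {V W : normedModType R} (f g : V -> W) U : open U ->
  {in U, f =1 g} -> smooth_on U f -> smooth_on U g.
Proof.
move=> oU fg sf.
have near_eq h k x : U x -> (forall y, U y -> h y = k y) ->
    \forall y \near x, h y = k y :> W.
  by move=> Ux hk; near=> y; apply: hk; near: y; exact: open_nbhs_nbhs.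
have E vs x : U x -> iter_derive vs f x = iter_derive vs g x.
  elim: vs x => [|v vs IH] x Ux /=; first by apply: fg; rewrite inE.
  by apply: near_eq_derive; exact: near_eq.
move=> vs x Ux; apply: near_eq_differentiable (sf vs x Ux).
by apply: near_eq => // y; exact: E.
Unshelve. all: by end_near. Qed.

Lemma smooth_onD {V W : normedModType R} (f g : V -> W) U : open U ->
  smooth_on U f -> smooth_on U g -> smooth_on U (f \+ g).
Proof.
move=> oU sf sg.
have near_eq h k x : U x -> (forall y, U y -> h y = k y) ->
    \forall y \near x, h y = k y :> W.
  by move=> Ux hk; near=> y; apply: hk; near: y; exact: open_nbhs_nbhs.
have E vs x : U x ->
    (iter_derive vs f \+ iter_derive vs g) x = iter_derive vs (f \+ g) x.
  elim: vs x => [|v vs IH] x Ux //=.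
  rewrite -deriveD; [|exact/diff_derivable/sf|exact/diff_derivable/sg].
  by apply: near_eq_derive; exact: near_eq.
move=> vs x Ux.
apply: (@near_eq_differentiable _ _ (iter_derive vs f \+ iter_derive vs g)).
  by apply: near_eq => // y; exact: E.
by apply: differentiableD; [exact: sf|exact: sg].
Unshelve. all: by end_near. Qed.

Lemma smooth_on_comp_linear {V V' W W' : normedModType R}
    (P : {linear V' -> V}) (Q : {linear W -> W'}) (f : V -> W) U : open U ->
  continuous P -> continuous Q ->
  smooth_on U f -> smooth_on (P @^-1` U) (Q \o f \o P).
Proof.
move=> oU Pc Qc sf.
have oPU : open (P @^-1` U) by apply: open_comp => // x _; exact: Pc.
have near_eq h k x : U (P x) -> (forall y, U (P y) -> h y = k y) ->
    \forall y \near x, h y = k y :> W'.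
  by move=> Ux hk; near=> y; apply: hk; near: y; exact: open_nbhs_nbhs.
have dP x : differentiable P x by exact: linear_differentiable.
have dQ x : differentiable Q x by exact: linear_differentiable.
have dQfP h x : differentiable h (P x) -> differentiable (Q \o h \o P) x.
  move=> dh; apply: differentiable_comp => //.
  by apply: differentiable_comp.
have E vs x : U (P x) ->
    (Q \o iter_derive (map P vs) f \o P) x = iter_derive vs (Q \o f \o P) x.
  elim: vs x => [|v vs IH] x Ux //=.
  transitivity ('D_v (Q \o iter_derive (map P vs) f \o P) x); last first.
    by apply: near_eq_derive; exact: near_eq.
  have dh := sf (map P vs) _ Ux.
  rewrite [RHS]deriveE; last exact: dQfP.
  rewrite diff_comp //; last exact: differentiable_comp.
  by rewrite /= diff_comp //= !diff_lin //= deriveE.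
move=> vs x Ux.
apply: (@near_eq_differentiable _ _ (Q \o iter_derive (map P vs) f \o P)).
  by apply: near_eq => // y; exact: E.
exact/dQfP/sf.
Unshelve. all: by end_near. Qed.
End SmoothMaps.

Section RowMx.
Context {R : realType} {k m : nat}.

Definition row_inl (u : 'rV[R]_k) : 'rV[R]_(k + m) := row_mx u 0.
Definition row_inr (v : 'rV[R]_m) : 'rV[R]_(k + m) := row_mx 0 v.

Fact row_inl_linear : linear row_inl.
Proof.
by move=> a u v; rewrite /row_inl scale_row_mx scaler0 add_row_mx addr0.
Qed.

Fact row_inr_linear : linear row_inr.
Proof.
by move=> a u v; rewrite /row_inr scale_row_mx scaler0 add_row_mx addr0.
Qed.

HB.instance Definition _ := GRing.isLinear.Build R _ _ _ row_inl row_inl_linear.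
HB.instance Definition _ := GRing.isLinear.Build R _ _ _ row_inr row_inr_linear.

Lemma row_inl_continuous : continuous row_inl.
Proof.
move=> u A /nbhs_ballP[e /= e0 eA].
apply/nbhs_ballP; exists e => //= v [_ uv]; apply: eA; split => // i j.
rewrite !mxE; case: (fintype.split j) => l; first exact: uv.
by rewrite !mxE; exact: ballxx.
Qed.

Lemma row_inr_continuous : continuous row_inr.
Proof.
move=> u A /nbhs_ballP[e /= e0 eA].
apply/nbhs_ballP; exists e => //= v [_ uv]; apply: eA; split => // i j.
rewrite !mxE; case: (fintype.split j) => l; last exact: uv.
by rewrite !mxE; exact: ballxx.
Qed.
End RowMx.

(* A smooth manifold of dimension [m], given by an atlas: [chart i] is a
   homeomorphism of the open set [dom i] onto the open set [cod i] of R^m with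
   inverse [param i]; values outside these sets are irrelevant. *)
Record manifold (R : realType) (m : nat) := Manifold {
  space :> topologicalType;
  space_hausdorff : hausdorff_space space;
  space_second_countable : @second_countable space;
  atlas : Type;
  dom : atlas -> set space;
  cod : atlas -> set 'rV[R]_m;
  chart : atlas -> space -> 'rV[R]_m;
  param : atlas -> 'rV[R]_m -> space;
  dom_cover : forall p, exists i, dom i p;
  dom_open : forall i, open (dom i);
  cod_open : forall i, open (cod i);
  chart_cod : forall i p, dom i p -> cod i (chart i p);
  param_dom : forall i x, cod i x -> dom i (param i x);
  chartK : forall i p, dom i p -> param i (chart i p) = p;
  paramK : forall i x, cod i x -> chart i (param i x) = x;
  chart_continuous : forall i p, dom i p -> {for p, continuous (chart i)};
  param_continuous : forall i x, cod i x -> {for x, continuous (param i)};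
  transition_smooth : forall i j,
    smooth_on [set x | cod i x /\ dom j (param i x)] (chart j \o param i)
}.

Section Tensors.
Context {R : realType} {m : nat} (N : manifold R m).

Definition transition (i j : atlas N) : 'rV[R]_m -> 'rV[R]_m :=
  chart j \o param i.

Definition overlap (i j : atlas N) : set 'rV[R]_m :=
  [set x | cod i x /\ dom j (param i x)].

(* Fields are given by their components in the charts, as functions of the
   coordinates. *)
Definition covector_field : Type := atlas N -> 'rV[R]_m -> 'cV[R]_m.
Definition matrix_field : Type := atlas N -> 'rV[R]_m -> 'M[R]_m.

Definition form1 (theta : covector_field) : Prop :=
  (forall i, smooth_on (cod i) (theta i)) /\
  (forall i j x, overlap i j x ->
     theta i x = pull1 (transition i j) (theta j) x).

Definition tensor02 (T : matrix_field) : Prop :=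
  (forall i, smooth_on (cod i) (T i)) /\
  (forall i j x, overlap i j x -> T i x = pull2 (transition i j) (T j) x).

Definition tensor11 (A : matrix_field) : Prop :=
  (forall i, smooth_on (cod i) (A i)) /\
  (forall i j x, overlap i j x ->
     A i x *m 'J (transition i j) x
     = 'J (transition i j) x *m A j (transition i j x)).

(* The tensor T(., A .) *)
Definition twist (T A : matrix_field) : matrix_field :=
  fun i x => T i x *m (A i x)^T.

Definition ricci_tensor (g : matrix_field) : matrix_field :=
  fun i => ricci (g i).

Definition riemannian (g : matrix_field) : Prop :=
  [/\ tensor02 g,
      forall i x, cod i x -> forall u v, bil (g i x) u v = bil (g i x) v u &
      forall i x, cod i x -> forall u, u != 0 -> 0 < bil (g i x) u u].

Definition kaehler (J g : matrix_field) : Prop :=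
  [/\ riemannian g,
      tensor11 J,
      forall i x, cod i x -> J i x *m J i x = - 1%:M,
      forall i x, cod i x -> forall u v,
        bil (g i x) (u *m J i x) (v *m J i x) = bil (g i x) u v &
      (* nabla J = 0 *)
      forall i X Y, smooth_on (cod i) X -> smooth_on (cod i) Y ->
        forall x, cod i x ->
        nabla (g i) X (fun y => Y y *m J i y) x = nabla (g i) X Y x *m J i x].

Definition is_exterior_derivative (theta : covector_field) (w : matrix_field) :
    Prop :=
  forall i X Y, smooth_on (cod i) X -> smooth_on (cod i) Y ->
    forall x, cod i x -> bil (w i x) (X x) (Y x) = ext_d1 (theta i) X Y x.

Definition form2 (B : matrix_field) : Prop :=
  tensor02 B /\
  forall i x, cod i x -> forall u v, bil (B i x) u v = - bil (B i x) v u.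

Definition closed_form2 (B : matrix_field) : Prop :=
  form2 B /\
  forall i X Y Z, smooth_on (cod i) X -> smooth_on (cod i) Y ->
    smooth_on (cod i) Z -> forall x, cod i x -> ext_d2 (B i) X Y Z x = 0.

End Tensors.

Section Cylinder.
Context {R : realType} {m : nat} (N : manifold R m).

Let space_cyl : topologicalType := (R * N)%type.
Let dom_cyl (i : atlas N) : set space_cyl := [set p | dom i p.2].
Let cod_cyl (i : atlas N) : set 'rV[R]_(1 + m) := [set z | cod i (rsubmx z)].
Let chart_cyl (i : atlas N) (p : space_cyl) : 'rV[R]_(1 + m) :=
  row_mx p.1%:M (chart i p.2).
Let param_cyl (i : atlas N) (z : 'rV[R]_(1 + m)) : space_cyl :=
  (lsubmx z 0 0, param i (rsubmx z)).

Lemma cylinder_hausdorff : hausdorff_space space_cyl.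
Proof.
move=> [s p] [t q] pq; congr (_, _).
  apply: (@Rhausdorff R) => A B sA tB.
  have [||[u v] [/= Au Bu]] := pq (A `*` setT) (B `*` setT).
  - by exists (A, setT) => //=; split => //; exact: filterT.
  - by exists (B, setT) => //=; split => //; exact: filterT.
  - by exists u; split; [exact: Au.1|exact: Bu.1].
apply: (@space_hausdorff _ _ N) => A B pA qB.
have [||[u v] [/= Au Bu]] := pq (setT `*` A) (setT `*` B).
- by exists (setT, A) => //=; split => //; exact: filterT.
- by exists (setT, B) => //=; split => //; exact: filterT.
- by exists v; split; [exact: Au.2|exact: Bu.2].
Qed.

Lemma cylinder_second_countable : @second_countable space_cyl.
Proof.
have [B Bc [Bo Bb]] := @space_second_countable _ _ N.
pose I (q : rat * rat) : set R := `]ratr q.1, ratr q.2[%classic.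
pose F (a : (rat * rat) * set N) : set space_cyl := I a.1 `*` a.2.
exists (F @` (setT `*` B)).
  apply: sub_countable (card_image_le _ _) _.
  by apply: countableX => //; exact: countableP.
split=> [_ [[q b] [_ /= Bb'] <-]|[t p] A [[P Q] /= [tP pQ] PQA]].
  rewrite openE => -[u v] [/= Iu bv].
  exists (I q, b) => //=; split; apply: open_nbhs_nbhs; split => //.
  exact: Bo.
have [b [Bb' bp] bQ] := Bb p Q pQ.
move/nbhs_ballP : tP => [e /= e0 eP].
have /rat_in_itvoo[q1 /itvP q1e] : t - e < t by rewrite ltrBlDr ltrDl.
have /rat_in_itvoo[q2 /itvP q2e] : t < t + e by rewrite ltrDl.
exists (F ((q1, q2), b)).
  split; first by exists ((q1, q2), b).
  by split => //=; rewrite /I /= in_itv /= q1e q2e.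
move=> [u v] [/=]; rewrite /I /= in_itv /= => /andP[q1u uq2] bv.
apply: PQA; split => /=; last exact: bQ.
apply: eP; rewrite /ball /= distrC ltr_distl.
by rewrite (lt_trans _ q1u) ?q1e //= (lt_trans uq2) ?q2e.
Qed.

Lemma cylinder_dom_cover p : exists i, dom_cyl i p.
Proof. by have [i ip] := dom_cover p.2; exists i. Qed.

Lemma cylinder_dom_open i : open (dom_cyl i).
Proof.
apply: (@open_comp _ _ snd) => [p _|]; last exact: dom_open.
exact: cvg_snd.
Qed.

Lemma cylinder_cod_open i : open (cod_cyl i).
Proof.
apply: (@open_comp _ _ rsubmx) => [z _|]; last exact: cod_open.
exact: continuous_rsubmx.
Qed.

Lemma cylinder_chart_cod i p : dom_cyl i p -> cod_cyl i (chart_cyl i p).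
Proof. by move=> ip; rewrite /cod_cyl /= row_mxKr; exact: chart_cod. Qed.

Lemma cylinder_param_dom i z : cod_cyl i z -> dom_cyl i (param_cyl i z).
Proof. exact: param_dom. Qed.

Lemma cylinder_chartK i p : dom_cyl i p -> param_cyl i (chart_cyl i p) = p.
Proof.
case: p => t p ip.
by rewrite /param_cyl row_mxKl row_mxKr !mxE eqxx mulr1n chartK.
Qed.

Lemma cylinder_paramK i z : cod_cyl i z -> chart_cyl i (param_cyl i z) = z.
Proof.
by move=> iz; rewrite /chart_cyl /= paramK // -mx11_scalar hsubmxK.
Qed.

Lemma cylinder_chart_continuous i p :
  dom_cyl i p -> {for p, continuous (chart_cyl i)}.
Proof.
move=> ip.
have -> : chart_cyl i =
    (fun q => row_inl (q.1%:M : 'rV[R]_1) + row_inr (chart i q.2)).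
  by apply/funext => q; rewrite /row_inl /row_inr add_row_mx addr0 add0r.
apply: (@continuousD R).
  apply: (@continuous_comp _ _ _ (fun q : space_cyl => (q.1%:M : 'rV[R]_1)));
    last exact: row_inl_continuous.
  apply: (@continuous_comp _ _ _ fst (fun t => (t%:M : 'rV[R]_1))).
    exact: cvg_fst.
  move=> A /nbhs_ballP[e /= e0 eA].
  apply/nbhs_ballP; exists e => //= s ts; apply: eA; split => // a b.
  by rewrite !mxE !ord1.
apply: (@continuous_comp _ _ _ (fun q : space_cyl => chart i q.2));
  last exact: row_inr_continuous.
apply: (@continuous_comp _ _ _ snd); first exact: cvg_snd.
exact: chart_continuous.
Qed.

Lemma cylinder_param_continuous i z :
  cod_cyl i z -> {for z, continuous (param_cyl i)}.
Proof.
move=> iz.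
have c1 : {for z, continuous (fun y : 'rV[R]_(1 + m) => lsubmx y 0 0 : R)}.
  apply: (@continuous_comp _ _ _ (@lsubmx R 1 1 m)
    (fun u : 'rV[R]_1 => u 0 0)).
    exact: continuous_lsubmx.
  exact: coord_continuous.
have c2 : {for z, continuous (fun y : 'rV[R]_(1 + m) => param i (rsubmx y))}.
  apply: (@continuous_comp _ _ _ (@rsubmx R 1 1 m) (param i)).
    exact: continuous_rsubmx.
  exact: param_continuous.
move=> A [[P Q] /= [zP zQ] PQA].
have H : nbhs z ((fun y : 'rV[R]_(1 + m) => lsubmx y 0 0 : R) @^-1` P `&`
    (fun y : 'rV[R]_(1 + m) => param i (rsubmx y)) @^-1` Q).
  by apply: filterI; [exact: c1|exact: c2].
by apply: filterS H => y [yP yQ]; exact: PQA.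
Qed.

Lemma cylinder_transition_smooth i j :
  smooth_on [set z | cod_cyl i z /\ dom_cyl j (param_cyl i z)]
    (chart_cyl j \o param_cyl i).
Proof.
pose U := [set x | cod i x /\ dom j (param i x)].
have oU : open U.
  rewrite openE => x [ix jx]; apply: filterI.
    by apply: open_nbhs_nbhs; split => //; exact: cod_open.
  apply: (param_continuous ix); apply: open_nbhs_nbhs; split => //.
  exact: dom_open.
rewrite -[X in smooth_on X _]/(rsubmx @^-1` U).
have -> : chart_cyl j \o param_cyl i =
    (row_inl \o lsubmx) \+
    (row_inr \o (chart j \o param i) \o rsubmx).
  apply/funext => z /=.
  by rewrite /chart_cyl /= -mx11_scalar add_row_mx addr0 add0r.
apply: smooth_onD.
- by apply: open_comp => // z _; exact: continuous_rsubmx.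
- apply: (@smooth_on_linear _ _ _ (row_inl \o lsubmx)) => z.
  by apply: continuous_comp; [exact: continuous_lsubmx|exact: row_inl_continuous].
- apply: smooth_on_comp_linear => //.
  + exact: continuous_rsubmx.
  + exact: row_inr_continuous.
  + exact: transition_smooth.
Qed.

(* R x N, with the charts (t, p) |-> (t, chart i p) *)
Definition cylinder : manifold R (1 + m) :=
  Manifold cylinder_hausdorff cylinder_second_countable cylinder_dom_cover
    cylinder_dom_open cylinder_cod_open cylinder_chart_cod cylinder_param_dom
    cylinder_chartK cylinder_paramK cylinder_chart_continuous
    cylinder_param_continuous cylinder_transition_smooth.
End Cylinder.

Section Lift.
Context {R : realType} {m : nat} {N : manifold R m}.
Implicit Types (tau : covector_field N) (g J T : matrix_field N).

(* In the charts of [cylinder N] and [N] with the same index the projection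
   [snd : R * N -> N] reads [rsubmx], and the coordinate [t] reads [lsubmx]. *)
Lemma projectionE i (z : 'rV[R]_(1 + m)) : @cod _ _ (cylinder N) i z ->
  @chart _ _ N i (@param _ _ (cylinder N) i z).2 = rsubmx z.
Proof. exact: (@paramK _ _ N). Qed.

Definition pi2_pull1 tau : covector_field (cylinder N) :=
  fun i => pull1 rsubmx (tau i).

Definition pi2_pull2 T : matrix_field (cylinder N) :=
  fun i => pull2 rsubmx (T i).

(* xi = d/dt *)
Definition xi : 'rV[R]_(1 + m) := row_mx 1%:M 0.

Definition dt : 'cV[R]_(1 + m) := col_mx 1%:M 0.

Definition eta tau : covector_field (cylinder N) :=
  fun i z => dt + pi2_pull1 tau i z.

Definition lift_metric tau g : matrix_field (cylinder N) :=
  fun i z => eta tau i z *m (eta tau i z)^T + pi2_pull2 g i z.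

(* The lift X^L = X - tau(X) xi at the point z of a tangent vector of N *)
Definition hlift tau (i : atlas N) (z : 'rV[R]_(1 + m)) (v : 'rV[R]_m) :
    'rV[R]_(1 + m) :=
  row_mx 0 v - pairing v (tau i (rsubmx z)) *: xi.

(* phi xi = 0 and phi X^L = (J X)^L *)
Definition is_lift_phi tau J (phi : matrix_field (cylinder N)) : Prop :=
  forall (i : atlas N) z, @cod _ _ (cylinder N) i z ->
    (xi *m phi i z = 0) /\
    (forall v, hlift tau i z v *m phi i z
               = hlift tau i z (v *m J i (rsubmx z))).

Lemma lift_phi_exists tau J : exists phi, is_lift_phi tau J phi.
Proof.
pose h i (z : 'rV[R]_(1 + m)) : 'M[R]_(m, 1 + m) :=
  row_mx 0 1%:M - tau i (rsubmx z) *m xi.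
have hE i z v : hlift tau i z v = v *m h i z.
  rewrite /hlift /h mulmxBr mul_mx_row mulmx0 mulmx1 mulmxA.
  by rewrite [v *m _ in RHS]mx11_scalar mul_scalar_mx.
exists (fun i z => col_mx 0 1%:M *m J i (rsubmx z) *m h i z) => i z _.
have xiE : xi *m col_mx 0 1%:M = 0 :> 'rV[R]_m.
  by rewrite mul_row_col mulmx0 mul0mx addr0.
split=> [|v]; first by rewrite !mulmxA xiE !mul0mx.
rewrite (hE _ _ (v *m _)) !mulmxA; congr (_ *m _ *m _).
rewrite /hlift mulmxBl -scalemxAl xiE scaler0 subr0.
by rewrite mul_row_col mul0mx mulmx1 add0r.
Qed.

Lemma lift_phi_unique tau J phi psi :
  is_lift_phi tau J phi -> is_lift_phi tau J psi ->
  forall (i : atlas N) z, @cod _ _ (cylinder N) i z -> phi i z = psi i z.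
Proof.
move=> Hphi Hpsi i z iz.
have [phi0 phiL] := Hphi i z iz; have [psi0 psiL] := Hpsi i z iz.
apply/row_matrixP => a; rewrite !rowE; set w := delta_mx _ _.
have -> : w = (lsubmx w 0 0 + pairing (rsubmx w) (tau i (rsubmx z))) *: xi
              + hlift tau i z (rsubmx w).
  rewrite scalerDl /hlift -addrA [_ *: xi + (_ - _)]addrC subrK.
  rewrite /xi scale_row_mx scaler0.
  rewrite add_row_mx addr0 add0r scalemx1 -mx11_scalar.
  by rewrite hsubmxK.
by rewrite [LHS]mulmxDl [RHS]mulmxDl phiL psiL -!scalemxAl phi0 psi0.
Qed.

End Lift.

(* Main.v *)
(* In the frame (xi, e_1^L, ..., e_m^L) the Levi-Civita connection of the lifted
   metric has an explicit block form in terms of J, omega and the connection of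
   g; torsion-freeness is the identity omega = d tau and metricity is the
   skew-symmetry of J.  Its curvature, computed in blocks with nabla J = 0 and
   traced, gives Ric^L(U, X^L) = Ric(U, X) - 2 g(U, X), hence the formula for
   rhobar.  Closedness then descends to N.  The form omega is closed because it is
   parallel.  For rho, the first Bianchi identity and the J-invariance of the
   curvature give rho(X, Y) = - 1/2 tr(J R(X, Y)), and since J is parallel
   the second Bianchi identity makes this trace closed.  Both tensors are
   2-forms on the manifold because the curvature is natural under transition
   maps. *)

Require Import Defs.
From HB Require Import structures.
From mathcomp Require Import all_boot all_order all_algebra.
From mathcomp Require Import all_classical all_reals all_analysis.
From mathcomp Require Import ring lra.
Import Order.TTheory GRing.Theory Num.Theory.
Import numFieldNormedType.Exports.
Local Open Scope classical_set_scope.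
Local Open Scope ring_scope.

Set Implicit Arguments.
Unset Strict Implicit.
Unset Printing Implicit Defensive.


(** * Smooth maps *)

(** A connection is handled as a matrix-valued 1-form [A u], and one lemma, [gauge_curv], is used
    four times: a matrix function K with K A_u + D_u K = A'_u K intertwines the two curvatures. With
    K the metric it gives skew-symmetry of the curvature, with K = J commutation with J, with K the
    Jacobian of a transition map naturality, and with K the matrix of the frame the passage from
    coordinates to (xi, e_1^L, ..., e_m^L). In this last case the frame serves only for the vectors
    on which the connection acts; the directions of differentiation stay constant coordinate
    vectors, so no bracket terms arise. The connections of a pulled-back and of a lifted metric are
    not extracted from the Christoffel formula: a candidate is written down and recognised as
    Levi-Civita by [conn_unique]. The constant -2 is a sum of three contributions to the trace: +1
    from the direction xi, -2 from the term in which d eta multiplies J, and -1 from the remaining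
    quadratic terms, one of which vanishes because tr J = 0. *)

Section Smoothness.
Context {R : realType} {m : nat}.
Implicit Types (U : set 'rV[R]_m) (x v w : 'rV[R]_m).

Lemma eq_on_open_near {T : Type} U x (f g : 'rV[R]_m -> T) :
  open U -> U x -> (forall y, U y -> f y = g y) -> \forall y \near x, f y = g y.
Proof.
by move=> oU Ux fg; near=> y; apply: fg; near: y; exact: open_nbhs_nbhs.
Unshelve. all: by end_near. Qed.

Lemma derive_eq_on_open {W : normedModType R} U x v (f g : 'rV[R]_m -> W) :
  open U -> U x -> (forall y, U y -> f y = g y) -> 'D_v f x = 'D_v g x.
Proof.
by move=> oU Ux fg; apply: near_eq_derive; exact: eq_on_open_near fg.
Qed.

Lemma differentiable_eq_on_open {W : normedModType R} U x (f g : 'rV[R]_m -> W) :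
  open U -> U x -> (forall y, U y -> f y = g y) ->
  differentiable f x -> differentiable g x.
Proof.
by move=> oU Ux fg; apply: near_eq_differentiable; exact: eq_on_open_near fg.
Qed.

(** Induction on the order serves all functions at once: the derivative of a product or of an
    inverse is a sum of products of other functions, which an induction on the list of directions in
    [smooth_on] cannot follow. Order 0 already means differentiable. *)
Fixpoint Ck {W : normedModType R} k U (f : 'rV[R]_m -> W) : Prop :=
  (forall x, U x -> differentiable f x) /\
  (if k is k'.+1 then forall v, Ck k' U ('D_v f) else True).

Lemma smooth_onP {W : normedModType R} U (f : 'rV[R]_m -> W) :
  smooth_on U f <-> forall k, Ck k U f.
Proof.
split=> [sf k|Cf vs].
  elim: k f sf => [|k IH] f sf /=; split=> //; try exact: (sf [::]).
  move=> v; apply: IH => vs x Ux.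
  by have := sf (rcons vs v) x Ux; rewrite /iter_derive foldr_rcons.
have {}Cf := Cf (size vs).
(* [Ck] differentiates [f] itself first, and in [iter_derive] the innermost derivative is the last
   of the list. *)
elim/last_ind: vs f Cf => [|vs v IH] f Cf x Ux.
  by case: Cf => + _; exact.
rewrite /iter_derive foldr_rcons; apply: IH => //.
by move: Cf; rewrite size_rcons => -[_]; exact.
Qed.

Lemma CkW {W : normedModType R} k U (f : 'rV[R]_m -> W) : Ck k.+1 U f -> Ck k U f.
Proof.
elim: k f => [|k IH] f [df Df]; split=> // v.
by apply: IH; exact: Df.
Qed.

Lemma Ck_eq {W : normedModType R} k U (f g : 'rV[R]_m -> W) : open U ->
  (forall y, U y -> f y = g y) -> Ck k U f -> Ck k U g.
Proof.
move=> oU; elim: k f g => [|k IH] f g fg [df Df]; split=> //.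
- by move=> x Ux; exact: differentiable_eq_on_open fg (df _ _).
- by move=> x Ux; exact: differentiable_eq_on_open fg (df _ _).
- by move=> v; apply: IH (Df v) => y Uy; exact: derive_eq_on_open fg.
Qed.

Lemma smooth_on_cst {W : normedModType R} U (c : W) :
  smooth_on U (cst c : 'rV[R]_m -> W).
Proof.
apply/smooth_onP => k; elim: k c => [|k IH] c; split=> // v.
have -> : 'D_v (cst c : 'rV[R]_m -> W) = cst 0.
  by apply/funext => x; rewrite derive_cst.
exact: IH.
Qed.

Lemma smooth_on_derive {W : normedModType R} U (f : 'rV[R]_m -> W) v :
  smooth_on U f -> smooth_on U ('D_v f).
Proof.
move=> sf vs x Ux; have := sf (rcons vs v) x Ux.
by rewrite /iter_derive foldr_rcons.
Qed.

Lemma CkD {W : normedModType R} k U (f g : 'rV[R]_m -> W) : open U ->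
  Ck k U f -> Ck k U g -> Ck k U (fun x => f x + g x).
Proof.
move=> oU; elim: k f g => [|k IH] f g [df Df] [dg Dg]; split=> //.
- by move=> x Ux; apply: differentiableD; [exact: df|exact: dg].
- by move=> x Ux; apply: differentiableD; [exact: df|exact: dg].
- move=> v; apply: Ck_eq (IH _ _ (Df v) (Dg v)) => // x Ux.
  by rewrite -[RHS]/('D_v (f + g) x) deriveD //; apply/diff_derivable;
    [exact: df|exact: dg].
Qed.

Lemma CkM k U (f g : 'rV[R]_m -> R) : open U ->
  Ck k U f -> Ck k U g -> Ck k U (fun x => f x * g x).
Proof.
move=> oU; elim: k f g => [|k IH] f g Cf Cg.
  by case: Cf Cg => [df _] [dg _]; split=> // x Ux;
    apply: differentiableM; [exact: df|exact: dg].
have [[df Df] [dg Dg]] := (Cf, Cg); split=> [x Ux|v].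
  by apply: differentiableM; [exact: df|exact: dg].
have := CkD oU (IH _ _ (CkW Cf) (Dg v)) (IH _ _ (CkW Cg) (Df v)).
apply: Ck_eq => // x Ux.
rewrite -[RHS]/('D_v (f * g) x) deriveM //; apply/diff_derivable;
  [exact: df|exact: dg].
Qed.

(** The derivative of 1/f is - (1/f)^2 D f, so the induction hypothesis for 1/f at the lower order
    closes the step. *)
Lemma CkV k U (f : 'rV[R]_m -> R) : open U -> (forall x, U x -> f x != 0) ->
  Ck k U f -> Ck k U (fun x => (f x)^-1).
Proof.
move=> oU f0; elim: k f f0 => [|k IH] f f0 Cf.
  by case: Cf => [df _]; split=> // x Ux; apply: differentiableV; auto.
have [df Df] := Cf; split=> [x Ux|v]; first by apply: differentiableV; auto.
have CV := IH _ f0 (CkW Cf).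
have Cm : Ck k U (cst (-1) : 'rV[R]_m -> R) by move: k {IH Cf CV Df};
  apply/smooth_onP/smooth_on_cst.
have := CkM oU Cm (CkM oU (CkM oU CV CV) (Df v)).
apply: Ck_eq => // x Ux.
rewrite [RHS]deriveV ?f0 //; last exact/diff_derivable/df.
by rewrite /cst /= /GRing.scale /= mulN1r mulNr -exprVn expr2.
Qed.

Lemma smooth_on_add {W : normedModType R} U (f g : 'rV[R]_m -> W) : open U ->
  smooth_on U f -> smooth_on U g -> smooth_on U (fun x => f x + g x).
Proof.
by move=> oU /smooth_onP sf /smooth_onP sg; apply/smooth_onP => k; exact: CkD.
Qed.

Lemma smooth_on_mul U (f g : 'rV[R]_m -> R) : open U ->
  smooth_on U f -> smooth_on U g -> smooth_on U (fun x => f x * g x).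
Proof.
by move=> oU /smooth_onP sf /smooth_onP sg; apply/smooth_onP => k; exact: CkM.
Qed.

Lemma smooth_on_inv U (f : 'rV[R]_m -> R) : open U -> (forall x, U x -> f x != 0) ->
  smooth_on U f -> smooth_on U (fun x => (f x)^-1).
Proof. by move=> oU f0 /smooth_onP sf; apply/smooth_onP => k; exact: CkV. Qed.

Lemma smooth_on_sum {W : normedModType R} {I : Type} (r : seq I) (P : pred I) U
    (F : I -> 'rV[R]_m -> W) : open U ->
  (forall i, P i -> smooth_on U (F i)) ->
  smooth_on U (fun x => \sum_(i <- r | P i) F i x).
Proof.
move=> oU sF; elim: r => [|i r IH].
  by under eq_fun do rewrite big_nil; exact: smooth_on_cst.
case Pi: (P i); under eq_fun do rewrite big_cons Pi; last exact: IH.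
by apply: smooth_on_add => //; exact: sF.
Qed.

Lemma smooth_on_prod {I : Type} (r : seq I) (P : pred I) U
    (F : I -> 'rV[R]_m -> R) : open U ->
  (forall i, P i -> smooth_on U (F i)) ->
  smooth_on U (fun x => \prod_(i <- r | P i) F i x).
Proof.
move=> oU sF; elim: r => [|i r IH].
  by under eq_fun do rewrite big_nil; exact: smooth_on_cst.
case Pi: (P i); under eq_fun do rewrite big_cons Pi; last exact: IH.
by apply: smooth_on_mul => //; exact: sF.
Qed.

Lemma differentiable_mxP {p q} (M : 'rV[R]_m -> 'M[R]_(p, q)) x :
  differentiable M x <-> forall i j, differentiable (fun y => M y i j) x.
Proof.
split=> [dM i j|dM].
  by apply: (@differentiable_comp _ _ _ _ M (fun A : 'M[R]_(p, q) => A i j)) => //;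
    exact: differentiable_coord.
have -> : M = \sum_(i < p) \sum_(j < q) (fun y => M y i j *: delta_mx i j).
  apply/funext => y; rewrite fct_sumE [LHS]matrix_sum_delta.
  by apply: eq_bigr => i _; rewrite fct_sumE.
apply: differentiable_sum => i; apply: differentiable_sum => j.
exact: differentiableZl.
Qed.

Lemma smooth_on_mxP {p q} U (M : 'rV[R]_m -> 'M[R]_(p, q)) : open U ->
  smooth_on U M <-> forall i j, smooth_on U (fun y => M y i j).
Proof.
move=> oU; split=> [/smooth_onP CM i j|CM]; apply/smooth_onP => k.
  elim: k M {CM}(CM k) => [|k IH] M [dM DM]; split=> //.
  - by move=> x /dM; rewrite differentiable_mxP.
  - by move=> x /dM; rewrite differentiable_mxP.
  - move=> v; apply: Ck_eq (IH _ (DM v)) => // x Ux.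
    by rewrite derive_entry //; exact: dM.
have {}CM i j : Ck k U (fun y => M y i j) by move: k; apply/smooth_onP.
elim: k M CM => [|k IH] M CM; split=> //.
- by move=> x Ux; apply/differentiable_mxP => i j; have [+ _] := CM i j; exact.
- by move=> x Ux; apply/differentiable_mxP => i j; have [+ _] := CM i j; exact.
- move=> v; apply: IH => i j; have [_ /(_ v)] := CM i j.
  apply: Ck_eq => // x Ux; rewrite derive_entry //.
  by apply/differentiable_mxP => a b; have [+ _] := CM a b; exact.
Qed.

Lemma smooth_on_mulmx {p q r} U (M : 'rV[R]_m -> 'M[R]_(p, q))
    (M' : 'rV[R]_m -> 'M[R]_(q, r)) : open U ->
  smooth_on U M -> smooth_on U M' -> smooth_on U (fun x => M x *m M' x).
Proof.
move=> oU /(smooth_on_mxP _ oU) sM /(smooth_on_mxP _ oU) sM'.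
apply/smooth_on_mxP => // i j; under eq_fun do rewrite mxE.
by apply: smooth_on_sum => // k _; exact: smooth_on_mul.
Qed.

Lemma smooth_on_trmx {p q} U (M : 'rV[R]_m -> 'M[R]_(p, q)) : open U ->
  smooth_on U M -> smooth_on U (fun x => (M x)^T).
Proof.
move=> oU /(smooth_on_mxP _ oU) sM.
by apply/smooth_on_mxP => // i j; under eq_fun do rewrite mxE; exact: sM.
Qed.

Lemma smooth_on_scale {p q} U (f : 'rV[R]_m -> R) (M : 'rV[R]_m -> 'M[R]_(p, q)) :
  open U -> smooth_on U f -> smooth_on U M -> smooth_on U (fun x => f x *: M x).
Proof.
move=> oU sf /(smooth_on_mxP _ oU) sM.
by apply/smooth_on_mxP => // i j; under eq_fun do rewrite mxE; exact: smooth_on_mul.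
Qed.

Lemma smooth_on_det {p} U (M : 'rV[R]_m -> 'M[R]_p) : open U ->
  smooth_on U M -> smooth_on U (fun x => \det (M x)).
Proof.
move=> oU /(smooth_on_mxP _ oU) sM; rewrite /determinant.
apply: smooth_on_sum => // s _; apply: smooth_on_mul => //.
  exact: smooth_on_cst.
exact: smooth_on_prod.
Qed.

(** Cramer's rule: on [U] the inverse is the adjugate divided by the determinant, both polynomial in
    the entries. *)
Lemma smooth_on_invmx {p} U (M : 'rV[R]_m -> 'M[R]_p) : open U ->
  (forall x, U x -> M x \in unitmx) ->
  smooth_on U M -> smooth_on U (fun x => invmx (M x)).
Proof.
move=> oU uM sM.
apply: (@smooth_on_eq _ _ _ (fun x => (\det (M x))^-1 *: \adj (M x))) => //.
  by move=> x; rewrite inE => Ux; rewrite /invmx uM.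
apply: smooth_on_scale => //.
  apply: smooth_on_inv => //; last exact: smooth_on_det.
  by move=> x /uM; rewrite unitmxE unitfE.
apply/smooth_on_mxP => // i j; under eq_fun do rewrite !mxE.
apply: smooth_on_mul => //; first exact: smooth_on_cst.
apply: smooth_on_det => //; apply/smooth_on_mxP => // a b.
by under eq_fun do rewrite !mxE; move/(smooth_on_mxP _ oU): sM; exact.
Qed.

Lemma smooth_on_diff {W : normedModType R} U (f : 'rV[R]_m -> W) x :
  smooth_on U f -> U x -> differentiable f x.
Proof. exact: (fun sf => sf [::] x). Qed.

End Smoothness.

(** * Symmetry of second derivatives *)

Section SymmetryOfSecondDerivatives.
Context {R : realType} {m : nat}.
Implicit Types (U : set 'rV[R]_m) (x u v w : 'rV[R]_m).

Lemma is_derive_line (f : 'rV[R]_m -> R) x u (s : R) :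
  differentiable f (x + s *: u) ->
  is_derive s 1 (fun t : R => f (x + t *: u)) ('D_u f (x + s *: u)).
Proof.
move=> df; have du := @diff_derivable _ _ _ f _ u df.
have E : (fun h : R => h^-1 *: (((fun t : R => f (x + t *: u)) \o shift s)
    (h *: (1 : R^o)) - f (x + s *: u))) =
  (fun h : R => h^-1 *: ((f \o shift (x + s *: u)) (h *: u) - f (x + s *: u))).
  apply/funext => h /=; rewrite /shift /=; congr (_ *: (f _ - _)).
  by rewrite [h *: (1 : R^o)]mulr1 scalerDl addrCA.
by split; rewrite /derivable /derive E.
Qed.

(** The mean value theorem is applied twice: to [p], a difference of [f] along two parallel sides in
    direction [u], then to [q], the derivative D_u f along [v]. The hypothesis keeps the whole
    parallelogram inside [U]. *)
Lemma second_difference U (f : 'rV[R]_m -> R) x u v (h : R) :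
  smooth_on U f -> 0 < h ->
  (forall s r : R, 0 <= s <= h -> 0 <= r <= h -> U (x + s *: u + r *: v)) ->
  exists s r : R, [/\ 0 < s < h, 0 < r < h &
    f (x + h *: u + h *: v) - f (x + h *: u) - f (x + h *: v) + f x
    = h ^+ 2 * 'D_v ('D_u f) (x + s *: u + r *: v)].
Proof.
move=> sf h0 hU.
have line s : 0 <= s <= h -> U (x + h *: v + s *: u) /\ U (x + s *: u).
  move=> s0h; split; first by rewrite addrAC; apply: hU => //; rewrite lexx (ltW h0).
  by have := hU _ 0 s0h; rewrite scale0r addr0; apply; rewrite lexx (ltW h0).
pose p s := f (x + h *: v + s *: u) - f (x + s *: u).
pose dp s := 'D_u f (x + h *: v + s *: u) - 'D_u f (x + s *: u).
have Dp s : 0 <= s <= h -> is_derive s 1 p (dp s).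
  move=> /line [U1 U2].
  by apply: is_deriveB; apply: is_derive_line; exact: smooth_on_diff sf _.
have [||s] := @MVT _ p dp 0 h h0.
- by move=> s; rewrite in_itv /= => /andP[s0 sh]; apply: Dp; rewrite !ltW.
- apply: derivable_within_continuous => s; rewrite in_itv /= => sh.
  by have [] := Dp s sh.
rewrite in_itv /= => s0h; rewrite subr0 => Es.
have sh : 0 <= s <= h by case/andP: s0h => s0 sh; rewrite !ltW.
pose q r := 'D_u f (x + s *: u + r *: v).
have Dq r : 0 <= r <= h -> is_derive r 1 q ('D_v ('D_u f) (x + s *: u + r *: v)).
  move=> rh; apply: is_derive_line.
  by apply: smooth_on_diff (smooth_on_derive u sf) _; exact: hU.
have [||r] := @MVT _ q (fun r => 'D_v ('D_u f) (x + s *: u + r *: v)) 0 h h0.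
- by move=> r; rewrite in_itv /= => /andP[r0 rh]; apply: Dq; rewrite !ltW.
- apply: derivable_within_continuous => r; rewrite in_itv /= => rh.
  by have [] := Dq r rh.
rewrite in_itv /= => r0h; rewrite subr0 => Er.
exists s, r; split => //.
have -> : f (x + h *: u + h *: v) - f (x + h *: u) - f (x + h *: v) + f x
    = p h - p 0.
  by rewrite /p scale0r !addr0 [x + h *: v + _]addrAC; ring.
rewrite Es; have -> : dp s = q h - q 0.
  by rewrite /dp /q scale0r addr0 addrAC.
by rewrite Er expr2; ring.
Qed.

Lemma dist_le_of_halves (a b c e : R) :
  `|a - b| < e / 2 -> `|b - c| < e / 2 -> `|a - c| <= e.
Proof.
move=> ab bc; rewrite -(subrKA b) (splitr e).
by apply: le_trans (ler_normD _ _) _; apply: lerD; exact: ltW.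
Qed.

(** Schwarz's theorem. The second difference is symmetric in [u] and [v], so the two mixed
    derivatives agree at two points of a small parallelogram; continuity of both at [x] then makes
    their values at [x] arbitrarily close. *)
Lemma derive_comm_scalar U (f : 'rV[R]_m -> R) x u v :
  open U -> smooth_on U f -> U x -> 'D_u ('D_v f) x = 'D_v ('D_u f) x.
Proof.
move=> oU sf Ux; apply/eqP; rewrite -subr_eq0 -normr_le0.
apply/ler_addgt0Pr => e e0; rewrite add0r.
have cont a b : \forall y \near x, `|'D_a ('D_b f) x - 'D_a ('D_b f) y| < e / 2.
  have c : {for x, continuous ('D_a ('D_b f))}.
    apply: differentiable_continuous.
    exact: smooth_on_diff (smooth_on_derive a (smooth_on_derive b sf)) Ux.
  by move/cvgrPdist_lt: c; apply; rewrite divr_gt0.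
have Un : nbhs x U by exact: open_nbhs_nbhs.
have [d /= d0 dP] := nbhs_norm_le_nbhs (filterI Un (filterI (cont u v) (cont v u))).
(* With this side length every point of the parallelogram lies at distance less than [d] from [x];
   the summand 1 keeps the denominator positive when [u] and [v] vanish. *)
pose h := d / (`|u| + `|v| + 1).
have n0 : 0 < `|u| + `|v| + 1 by rewrite ltr_wpDl // addr_ge0.
have h0 : 0 < h by rewrite divr_gt0.
have near_line s r : 0 <= s <= h -> 0 <= r <= h ->
    ball_ Num.norm x d (x + s *: u + r *: v).
  move=> /andP[s0 sh] /andP[r0 rh]; rewrite /= -addrA opprD addNKr normrN.
  rewrite (le_lt_trans (ler_normD _ _)) // !normrZ !ger0_norm //.
  have -> : d = h * (`|u| + `|v| + 1) by rewrite divfK // gt_eqF.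
  rewrite !mulrDr mulr1 -addrA; apply: ler_ltD; first exact: ler_wpM2r.
  rewrite (le_lt_trans (_ : _ <= h * `|v|)) ?ltrDl //; exact: ler_wpM2r.
clearbody h.
have [s [r [/andP[s0 sh] /andP[r0 rh] E1]]] : exists s r : R,
  [/\ 0 < s < h, 0 < r < h &
    f (x + h *: u + h *: v) - f (x + h *: u) - f (x + h *: v) + f x
    = h ^+ 2 * 'D_v ('D_u f) (x + s *: u + r *: v)].
  apply: second_difference sf h0 _ => s r sh rh.
  by have [] := dP _ (near_line _ _ sh rh).
have [r' [s' [/andP[r0' rh'] /andP[s0' sh'] E2]]] : exists s r : R,
  [/\ 0 < s < h, 0 < r < h &
    f (x + h *: v + h *: u) - f (x + h *: v) - f (x + h *: u) + f x
    = h ^+ 2 * 'D_u ('D_v f) (x + s *: v + r *: u)].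
  apply: second_difference sf h0 _ => a b ah bh; rewrite addrAC.
  by have [] := dP _ (near_line _ _ bh ah).
(* [E1] and [E2] evaluate the same second difference, up to the order of its terms. *)
have E : 'D_v ('D_u f) (x + s *: u + r *: v) = 'D_u ('D_v f) (x + s' *: u + r' *: v).
  have h2 : h ^+ 2 != 0 by rewrite expf_neq0 // gt_eqF.
  rewrite [x + s' *: u + _]addrAC; apply: (mulfI h2).
  apply: etrans (esym E1) _; apply: etrans E2.
  by rewrite [x + h *: v + _]addrAC; congr (_ + _); rewrite [LHS]addrAC.
have in_line t : 0 < t -> t < h -> 0 <= t <= h by move=> t0 th; rewrite !ltW.
have [_ [_ B1]] := dP _ (near_line s r (in_line _ s0 sh) (in_line _ r0 rh)).
have [_ [B2 _]] := dP _ (near_line s' r' (in_line _ s0' sh') (in_line _ r0' rh')).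
rewrite E distrC in B1.
exact: dist_le_of_halves B2 B1.
Qed.

Lemma derive_comm {p q} U (f : 'rV[R]_m -> 'M[R]_(p, q)) x u v :
  open U -> smooth_on U f -> U x -> 'D_u ('D_v f) x = 'D_v ('D_u f) x.
Proof.
move=> oU sf Ux.
have D a y : U y -> differentiable ('D_a f) y.
  by move=> Uy; exact: smooth_on_diff (smooth_on_derive a sf) Uy.
have df y : U y -> differentiable f y by move=> Uy; exact: smooth_on_diff sf Uy.
apply/matrixP => i j.
have E a b : ('D_a ('D_b f) x) i j = 'D_a ('D_b (fun y => f y i j)) x.
  apply: etrans (esym (derive_entry a i j (D b x Ux))) _.
  apply: derive_eq_on_open oU Ux _ => y Uy.
  exact: esym (derive_entry b i j (df y Uy)).
apply: etrans (E u v) _; apply: etrans _ (esym (E v u)).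
exact: derive_comm_scalar oU ((smooth_on_mxP _ oU).1 sf i j) Ux.
Qed.

End SymmetryOfSecondDerivatives.

(** * Matrix calculus and curvature *)

Section MatrixCalculus.
Context {R : realType} {m : nat}.
Implicit Types (U : set 'rV[R]_m) (x u v w : 'rV[R]_m).

Lemma linear_rowE {p q} (f : 'rV[R]_m -> 'M[R]_(p, q)) u :
  linear f -> f u = \sum_c u 0 c *: f (delta_mx 0 c).
Proof.
move=> lf; pose b : {linear 'rV[R]_m -> 'M[R]_(p, q)} :=
  HB.pack f (GRing.isLinear.Build _ _ _ _ f lf).
rewrite [in LHS](row_sum_delta u) -[f _]/(b _) linear_sum.
by apply: eq_bigr => c _; rewrite linearZ.
Qed.

Lemma linear_mulmx_ex {p} (f : 'rV[R]_m -> 'rV[R]_p) :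
  linear f -> exists L : 'M[R]_(m, p), forall w, f w = w *m L.
Proof.
move=> lf; exists (\matrix_k f (delta_mx 0 k)) => w.
by rewrite (linear_rowE w lf) mulmx_sum_row; apply: eq_bigr => k _; rewrite rowK.
Qed.

Lemma differentiable_mulmx {p q r} (A : 'rV[R]_m -> 'M[R]_(p, q))
    (B : 'rV[R]_m -> 'M[R]_(q, r)) x :
  differentiable A x -> differentiable B x ->
  differentiable (fun y => A y *m B y) x.
Proof.
move=> /differentiable_mxP dA /differentiable_mxP dB.
apply/differentiable_mxP => i j.
have -> : (fun y => (A y *m B y) i j) = \sum_k (fun y => A y i k * B y k j).
  by apply/funext => y; rewrite mxE fct_sumE.
by apply: differentiable_sum => k; apply: differentiableM.
Qed.

Lemma derive_mulmx {p q r} (A : 'rV[R]_m -> 'M[R]_(p, q))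
    (B : 'rV[R]_m -> 'M[R]_(q, r)) x v :
  differentiable A x -> differentiable B x ->
  'D_v (fun y => A y *m B y) x = 'D_v A x *m B x + A x *m 'D_v B x.
Proof.
move=> dA dB; apply/matrixP => i j.
apply: etrans (esym (derive_entry v i j (differentiable_mulmx dA dB))) _.
have -> : (fun y => (A y *m B y) i j) =
    \sum_k ((fun y => A y i k) * (fun y => B y k j)).
  by apply/funext => y; rewrite mxE fct_sumE.
rewrite derive_sum; last by move=> k; apply: derivableM; exact: derivable_entry.
rewrite !mxE -big_split /=; apply: eq_bigr => k _.
rewrite deriveM; [|exact: derivable_entry|exact: derivable_entry].
rewrite (derive_entry v i k dA) (derive_entry v k j dB) /GRing.scale /=.
rewrite addrC [X in _ + X = _]mulrC; exact: erefl.
Qed.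

Lemma differentiable_trmx {p q} (A : 'rV[R]_m -> 'M[R]_(p, q)) x :
  differentiable A x -> differentiable (fun y => (A y)^T) x.
Proof.
move=> /differentiable_mxP dA; apply/differentiable_mxP => i j.
by under eq_fun do rewrite mxE; exact: dA.
Qed.

Lemma derive_trmx {p q} (A : 'rV[R]_m -> 'M[R]_(p, q)) x v :
  differentiable A x -> 'D_v (fun y => (A y)^T) x = ('D_v A x)^T.
Proof.
move=> dA; apply/matrixP => i j.
apply: etrans (esym (derive_entry v i j (differentiable_trmx dA))) _.
by rewrite [RHS]mxE -(derive_entry v j i dA); congr ('D_v _ x); apply/funext => y;
  rewrite mxE.
Qed.

Lemma derive_dir_linear {W : normedModType R} (f : 'rV[R]_m -> W) x :
  differentiable f x -> linear (fun u => 'D_u f x).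
Proof. by move=> df a u v; rewrite !deriveE // linearP. Qed.

Lemma derive_mulmxl {p q r} (C : 'M[R]_(p, q)) (B : 'rV[R]_m -> 'M[R]_(q, r)) x v :
  differentiable B x -> 'D_v (fun y => C *m B y) x = C *m 'D_v B x.
Proof.
move=> dB; have := derive_mulmx v (differentiable_cst C x) dB.
by rewrite derive_cst mul0mx add0r.
Qed.

Lemma derive_mulmxr {p q r} (A : 'rV[R]_m -> 'M[R]_(p, q)) (C : 'M[R]_(q, r)) x v :
  differentiable A x -> 'D_v (fun y => A y *m C) x = 'D_v A x *m C.
Proof.
move=> dA; have := derive_mulmx v dA (differentiable_cst C x).
by rewrite derive_cst mulmx0 addr0.
Qed.

Lemma derive_addmx {p q} (A B : 'rV[R]_m -> 'M[R]_(p, q)) x v :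
  differentiable A x -> differentiable B x ->
  'D_v (fun y => A y + B y) x = 'D_v A x + 'D_v B x.
Proof. by move=> dA dB; apply: deriveD; exact: diff_derivable. Qed.

Lemma derive_oppmx {p q} (A : 'rV[R]_m -> 'M[R]_(p, q)) x v :
  differentiable A x -> 'D_v (fun y => - A y) x = - 'D_v A x.
Proof. by move=> dA; apply: deriveN; exact: diff_derivable. Qed.

End MatrixCalculus.

Lemma addmxE {R : realType} {p q} (A B : 'M[R]_(p, q)) i j :
  (A + B) i j = A i j + B i j.
Proof. by rewrite mxE. Qed.

Lemma oppmxE {R : realType} {p q} (A : 'M[R]_(p, q)) i j : (- A) i j = - A i j.
Proof. by rewrite mxE. Qed.

Lemma scalemxE {R : realType} {p q} a (A : 'M[R]_(p, q)) i j :
  (a *: A) i j = a * A i j.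
Proof. by rewrite mxE. Qed.

Lemma zeromxE {R : realType} {p q} i j : (0 : 'M[R]_(p, q)) i j = 0.
Proof. by rewrite mxE. Qed.

(** Entries of sums, opposites and scalings are expanded, but those of products are not: once the
    products are in a common form they are atoms for [ring]. *)
Ltac mx_linear :=
  apply/matrixP => ? ?; rewrite ?(addmxE, oppmxE, scalemxE, zeromxE); ring.

Section Curvature.
Context {R : realType} {m : nat}.
Implicit Types (U : set 'rV[R]_m) (x u v w : 'rV[R]_m).

(* [A u] acts on row vectors from the right, whence the order of the products
   in the curvature of the connection [D_u + A u]. *)
Definition curv {p} (A : 'rV[R]_m -> 'rV[R]_m -> 'M[R]_p) u v x : 'M[R]_p :=
  'D_u (A v) x - 'D_v (A u) x + A v x *m A u x - A u x *m A v x.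

(** The hypotheses are the relation K A + D K = B K in two directions and its derivatives at one
    point. The mixed second derivative of K enters both derivatives as the same matrix [D2K] and
    cancels in their difference; the first derivatives of K are then eliminated through the relation
    itself. *)
Lemma gauge_algebra {p q} (K DuK DvK D2K : 'M[R]_(p, q))
    (Au Av DuAv DvAu : 'M[R]_q) (Bu Bv DuBv DvBu : 'M[R]_p) :
  K *m Au + DuK = Bu *m K -> K *m Av + DvK = Bv *m K ->
  DuK *m Av + K *m DuAv + D2K = DuBv *m K + Bv *m DuK ->
  DvK *m Au + K *m DvAu + D2K = DvBu *m K + Bu *m DvK ->
  K *m (DuAv - DvAu + Av *m Au - Au *m Av)
  = (DuBv - DvBu + Bv *m Bu - Bu *m Bv) *m K.
Proof.
move=> /(canRL (addrK _)) Eu /(canRL (addrK _)) Ev.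
move=> /(canRL (addrK _)) /(canRL (addKr _)) E1.
move=> /(canRL (addrK _)) /(canRL (addKr _)) E2.
rewrite !(mulmxDr, mulmxDl, mulmxN, mulNmx) E1 E2 !mulmxA Eu Ev.
rewrite !mulmxBl -!mulmxA Eu Ev !mulmxBr.
by mx_linear.
Qed.

(* The last hypothesis says that [K] is parallel for the connections [A'] and
   [A]. *)
Lemma gauge_curv {p q} U (K : 'rV[R]_m -> 'M[R]_(p, q))
    (A : 'rV[R]_m -> 'rV[R]_m -> 'M[R]_q) (A' : 'rV[R]_m -> 'rV[R]_m -> 'M[R]_p)
    u v x : open U -> U x -> smooth_on U K ->
  (forall a, differentiable (A a) x) -> (forall a, differentiable (A' a) x) ->
  (forall a y, U y -> K y *m A a y + 'D_a K y = A' a y *m K y) ->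
  K x *m curv A u v x = curv A' u v x *m K x.
Proof.
move=> oU Ux sK dA dA' KA.
have dK : differentiable K x by exact: smooth_on_diff sK Ux.
have dDK a : differentiable ('D_a K) x.
  exact: smooth_on_diff (smooth_on_derive a sK) Ux.
have E a b : 'D_b K x *m A a x + K x *m 'D_b (A a) x + 'D_b ('D_a K) x =
             'D_b (A' a) x *m K x + A' a x *m 'D_b K x.
  rewrite -(derive_mulmx b (dA' a) dK) -(derive_mulmx b dK (dA a)).
  rewrite -(derive_addmx b (differentiable_mulmx dK (dA a)) (dDK a)).
  exact: derive_eq_on_open oU Ux (KA a).
(* The only analytic input: the second derivatives of [K] in the two orders are one matrix, the
   [D2K] of the algebraic lemma. *)
have C := derive_comm u v oU sK Ux.
exact: gauge_algebra (KA u x Ux) (KA v x Ux) (E v u) (etrans (congr1 _ C) (E u v)).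
Qed.

Lemma curvC {p} (A : 'rV[R]_m -> 'rV[R]_m -> 'M[R]_p) u v x :
  curv A u v x = - curv A v u x.
Proof.
rewrite /curv; move: ('D_u _ x) ('D_v _ x) (A v x *m _) (A u x *m _) => a b c d.
by mx_linear.
Qed.

Lemma curv_linearl {p} (A : 'rV[R]_m -> 'rV[R]_m -> 'M[R]_p) v x :
  (forall y, linear (A^~ y)) -> (forall a, differentiable (A a) x) ->
  linear (fun u => curv A u v x).
Proof.
move=> lA dA a u u'.
have DA : 'D_v (A (a *: u + u')) x = a *: 'D_v (A u) x + 'D_v (A u') x.
  have -> : A (a *: u + u') = a \*: A u + A u' by apply/funext => y; exact: lA.
  rewrite deriveD; [|exact/derivableZ/diff_derivable|exact: diff_derivable].
  by rewrite deriveZ //; exact: diff_derivable.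
rewrite /curv DA (derive_dir_linear (dA v)) lA mulmxDr mulmxDl -scalemxAr -scalemxAl.
move: ('D_u (A v) x) ('D_u' (A v) x) ('D_v (A u) x) ('D_v (A u') x) => d1 d2 d3 d4.
by mx_linear.
Qed.

Lemma curv_linearr {p} (A : 'rV[R]_m -> 'rV[R]_m -> 'M[R]_p) u x :
  (forall y, linear (A^~ y)) -> (forall a, differentiable (A a) x) ->
  linear (fun v => curv A u v x).
Proof.
move=> lA dA a v v'; rewrite ![curv A u _ x]curvC (curv_linearl u lA dA).
by rewrite opprD scalerN.
Qed.

End Curvature.

(** * The Levi-Civita connection *)

Section Connection.
Context {R : realType} {m : nat}.
Implicit Types (U : set 'rV[R]_m) (x u v w : 'rV[R]_m) (G : 'rV[R]_m -> 'M[R]_m).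

(** The matrix of v |-> Gamma(u, v), acting from the right. Expanding [u] in coordinates makes it
    linear in [u] at every point, as [curv_linearl] and [derive_family] ask, whereas [christoffel]
    is shown linear at points of differentiability of [G]. *)
Definition conn G u x : 'M[R]_m :=
  \sum_c u 0 c *: \matrix_b christoffel G x (delta_mx 0 c) (delta_mx 0 b).

Lemma conn_linear G x : linear (conn G ^~ x).
Proof.
move=> a u v; rewrite /conn scaler_sumr -big_split /=; apply: eq_bigr => c _.
by rewrite !mxE scalerDl scalerA.
Qed.

Lemma bilDl (T : 'M[R]_m) a u v w : bil T (a *: u + v) w = a * bil T u w + bil T v w.
Proof. by rewrite /bil !mulmxDl -!scalemxAl !mxE. Qed.

Lemma bilDr (T : 'M[R]_m) a u v w : bil T w (a *: u + v) = a * bil T w u + bil T w v.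
Proof. by rewrite /bil linearP mulmxDr -scalemxAr !mxE. Qed.

Lemma bilDm (S T : 'M[R]_m) a u v : bil (a *: S + T) u v = a * bil S u v + bil T u v.
Proof. by rewrite /bil mulmxDr mulmxDl -scalemxAr -scalemxAl !mxE. Qed.

Lemma bil_delta (T : 'M[R]_m) i j : bil T (delta_mx 0 i) (delta_mx 0 j) = T i j.
Proof. by rewrite /bil -rowE trmx_delta -colE !mxE. Qed.

Lemma bil_inj (S T : 'M[R]_m) : (forall u v, bil S u v = bil T u v) -> S = T.
Proof. by move=> ST; apply/matrixP => i j; rewrite -!bil_delta. Qed.

(** Hides the derivative of [G] behind a linear map [D], so that the symmetries of the Christoffel
    symbols become pure bilinear algebra. *)
Lemma christoffel1E G x : differentiable G x ->
  exists D : 'rV[R]_m -> 'M[R]_m, [/\ linear D, forall u, 'D_u G x = D u &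
    forall u v w, christoffel1 G x u v w =
      2^-1 * (bil (D u) v w + bil (D v) u w - bil (D w) u v)].
Proof.
by move=> dG; exists (fun u => 'D_u G x); split=> //; exact: derive_dir_linear.
Qed.

Lemma christoffel_linearl G x v : differentiable G x ->
  linear (fun u => christoffel G x u v).
Proof.
move=> dG a u u'; rewrite /christoffel scalemxAl -mulmxDl; congr (_ *m _).
apply/rowP => l; rewrite !mxE.
have [D [lD _ E]] := christoffel1E dG; rewrite !E lD bilDm !bilDl.
by ring.
Qed.

Lemma christoffel_linearr G x u : differentiable G x ->
  linear (fun v => christoffel G x u v).
Proof.
move=> dG a v v'; rewrite /christoffel scalemxAl -mulmxDl; congr (_ *m _).
apply/rowP => l; rewrite !mxE.
have [D [lD _ E]] := christoffel1E dG; rewrite !E lD bilDm bilDl bilDr.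
by ring.
Qed.

Lemma christoffel_conn G x u v : differentiable G x ->
  christoffel G x u v = v *m conn G u x.
Proof.
move=> dG; rewrite (linear_rowE u (christoffel_linearl v dG)) /conn mulmx_sumr.
apply: eq_bigr => c _; rewrite -scalemxAr; congr (_ *: _).
rewrite (linear_rowE v (christoffel_linearr _ dG)) mulmx_sum_row.
by apply: eq_bigr => b _; rewrite rowK.
Qed.

Lemma smooth_on_bil U (T : 'rV[R]_m -> 'M[R]_m) u v : open U ->
  smooth_on U T -> smooth_on U (fun x => bil (T x) u v).
Proof.
move=> oU sT; apply: (smooth_on_mxP _ oU).1.
by apply: smooth_on_mulmx => //; [apply: smooth_on_mulmx => //|];
  exact: smooth_on_cst.
Qed.

Lemma smooth_on_christoffel1 U G u v w : open U -> smooth_on U G ->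
  smooth_on U (fun x => christoffel1 G x u v w).
Proof.
move=> oU sG; apply: smooth_on_mul => //; first exact: smooth_on_cst.
have s a b c : smooth_on U (fun x => bil ('D_a G x) b c).
  by apply: smooth_on_bil => //; exact: smooth_on_derive.
apply: smooth_on_add => //; first by apply: smooth_on_add.
apply: (@smooth_on_eq _ _ _ (fun x => -1 * bil ('D_w G x) u v)) => //.
  by move=> x _; rewrite mulN1r.
by apply: smooth_on_mul => //; exact: smooth_on_cst.
Qed.

Lemma smooth_on_conn U G u : open U -> smooth_on U G ->
  (forall x, U x -> G x \in unitmx) -> smooth_on U (conn G u).
Proof.
move=> oU sG uG; apply: smooth_on_sum => // c _.
apply: smooth_on_scale => //; first exact: smooth_on_cst.
apply/smooth_on_mxP => // b l; under eq_fun do rewrite mxE.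
apply: (smooth_on_mxP _ oU).1; apply: smooth_on_mulmx => //.
  apply/smooth_on_mxP => // ? ?; under eq_fun do rewrite mxE.
  exact: smooth_on_christoffel1.
exact: smooth_on_invmx.
Qed.

Lemma conn_sym U G x u v : open U -> U x -> differentiable G x ->
  (forall y, U y -> (G y)^T = G y) -> v *m conn G u x = u *m conn G v x.
Proof.
move=> oU Ux dG sG; rewrite -!christoffel_conn //.
rewrite /christoffel; congr (_ *m _); apply/rowP => l; rewrite !mxE.
have [D [_ DE E]] := christoffel1E dG.
rewrite !E (bil_sym u v); last by rewrite -DE; exact: derive_sym sG.
by ring.
Qed.

(** As a bilinear form, [conn G u x *m G x] is the Christoffel symbol of the first kind; adding its
    transpose cancels the two terms differentiated along the arguments and doubles the one along
    [u]. *)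
Lemma conn_metric U G x u : open U -> U x -> differentiable G x ->
  (forall y, U y -> (G y)^T = G y) -> G x \in unitmx ->
  'D_u G x = conn G u x *m G x + G x *m (conn G u x)^T.
Proof.
move=> oU Ux dG sG uG; apply: bil_inj => v w.
have L a b : bil (conn G u x *m G x) a b = christoffel1 G x u a b.
  by rewrite -christoffel_lower ?sG // christoffel_conn // /bil mulmxA.
have -> : bil (conn G u x *m G x + G x *m (conn G u x)^T) v w =
          bil (conn G u x *m G x) v w + bil (conn G u x *m G x) w v.
  rewrite -[conn G u x *m G x as X in X + _]scale1r bilDm mul1r; congr (_ + _).
  rewrite /bil -[LHS]trace_mx11 -mxtrace_tr !trmx_mul !trmxK sG // trace_mx11.
  by rewrite !mulmxA.
have [D [_ DE E]] := christoffel1E dG.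
rewrite !L !E DE (bil_sym w v); last by rewrite -DE; exact: derive_sym sG.
by field.
Qed.

(** The Koszul argument at a single point: a symmetric family of matrices compatible with the metric
    is the Levi-Civita one. Nothing is asked of [A] away from [x], so a candidate can be checked
    pointwise. *)
Lemma conn_unique G x (A : 'rV[R]_m -> 'M[R]_m) :
  linear A -> differentiable G x -> (G x)^T = G x -> G x \in unitmx ->
  (forall u v, v *m A u = u *m A v) ->
  (forall u, 'D_u G x = A u *m G x + G x *m (A u)^T) ->
  forall u, conn G u x = A u.
Proof.
move=> lA dG sG uG symA metA u; apply/row_matrixP => b; rewrite !rowE.
rewrite -christoffel_conn // /christoffel.
apply: (can_inj (mulmxK uG)); rewrite mulmxKV //; apply/rowP => l; rewrite mxE.
have [D [_ DE E]] := christoffel1E dG.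
have B v w1 w2 : bil (D v) w1 w2 = bil (G x) (w1 *m A v) w2 + bil (G x)
  (w2 *m A v) w1.
  rewrite -DE metA -[A v *m _]scale1r bilDm mul1r; congr (_ + _).
    by rewrite /bil mulmxA.
  rewrite /bil -[LHS]trace_mx11 -mxtrace_tr !trmx_mul !trmxK sG trace_mx11.
  by rewrite !mulmxA.
set v := delta_mx 0 b; set w := delta_mx 0 l.
rewrite E !B (symA u v) (symA u w) (symA v w).
(* Metricity turns the three derivatives into six terms; symmetry cancels four of them and
   identifies the other two. *)
transitivity (bil (G x) (u *m A v) w).
  by field.
by rewrite /bil trmx_delta -colE mxE.
Qed.

Lemma curvature_conn U G u v w x : open U -> smooth_on U G ->
  (forall y, U y -> G y \in unitmx) -> U x ->
  curvature G (cst u) (cst v) (cst w) x = w *m curv (conn G) u v x.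
Proof.
move=> oU sG uG Ux.
have dG y : U y -> differentiable G y by exact: smooth_on_diff.
have N a b y : U y -> nabla G (cst a) (cst b) y = b *m conn G a y.
  by move=> Uy; rewrite /nabla /= derive_cst add0r christoffel_conn //; exact: dG.
have N2 a b : nabla G (cst a) (nabla G (cst b) (cst w)) x =
    w *m 'D_a (conn G b) x + w *m conn G b x *m conn G a x.
  rewrite {1}/nabla /= (christoffel_conn _ _ (dG _ Ux)) N //; congr (_ + _).
  rewrite (derive_eq_on_open _ oU Ux (N b w)) derive_mulmxl //.
  exact: smooth_on_diff (smooth_on_conn b oU sG uG) Ux.
rewrite /curvature !N2.
have -> : lie_bracket (cst u) (cst v) = cst 0.
  by apply/funext => y; rewrite /lie_bracket !derive_cst subrr.
rewrite N //; have -> : conn G 0 x = 0.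
  by rewrite /conn big1 // => c _; rewrite mxE scale0r.
rewrite /curv !mulmxDr !mulmxN mulmx0 subr0 !mulmxA.
move: (w *m _) (w *m _) (w *m _ *m _) (w *m _ *m _) => a b c d.
by mx_linear.
Qed.

Lemma bil_ricci U G u v x : open U -> smooth_on U G ->
  (forall y, U y -> G y \in unitmx) -> U x ->
  bil (ricci G x) u v = \sum_k (v *m curv (conn G) (delta_mx 0 k) u x) 0 k.
Proof.
move=> oU sG uG Ux; rewrite bilE.
have lC k : linear (fun u => curv (conn G) (delta_mx 0 k) u x).
  apply: curv_linearr => [y|a]; first exact: conn_linear.
  exact: smooth_on_diff (smooth_on_conn a oU sG uG) Ux.
transitivity (\sum_i \sum_j \sum_k u 0 i * v 0 j * ((delta_mx 0 j : 'rV[R]_m) *m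
    curv (conn G) (delta_mx 0 k) (delta_mx 0 i) x) 0 k).
  apply: eq_bigr => i _; apply: eq_bigr => j _.
  rewrite mxE mulr_sumr mulr_suml; apply: eq_bigr => k _.
  by rewrite (curvature_conn _ _ _ oU sG uG Ux) mulrAC.
under eq_bigr do rewrite exchange_big /=.
rewrite exchange_big /=; apply: eq_bigr => k _.
rewrite (linear_rowE u (lC k)) mulmx_sumr summxE; apply: eq_bigr => i _.
rewrite -scalemxAr scalemxE {2}(row_sum_delta v) mulmx_suml summxE mulr_sumr.
by apply: eq_bigr => j _; rewrite -scalemxAl scalemxE mulrA.
Qed.

End Connection.

(** * Symmetries of the curvature *)

Section Traces.
Context {R : realType} {m : nat}.

Lemma row_trace (L : 'M[R]_m) :
  \sum_k ((delta_mx 0 k : 'rV[R]_m) *m L) 0 k = \tr L.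
Proof. by apply: eq_bigr => k _; rewrite -rowE mxE. Qed.

(** This is tr (J L) = tr (L J), in the form that moves J from the argument summed over to the
    value. *)
Lemma row_trace_comm (f : 'rV[R]_m -> 'rV[R]_m) (J : 'M[R]_m) : linear f ->
  \sum_k f (delta_mx 0 k *m J) 0 k = \sum_k (f (delta_mx 0 k) *m J) 0 k.
Proof.
move=> /linear_mulmx_ex[L fL].
under eq_bigr do rewrite fL -mulmxA.
under [RHS]eq_bigr do rewrite fL -mulmxA.
by rewrite !row_trace mxtrace_mulC.
Qed.

Lemma bil_mulr (T A : 'M[R]_m) u v : bil (T *m A^T) u v = bil T u (v *m A).
Proof. by rewrite /bil trmx_mul !mulmxA. Qed.

Lemma bil_mull (T A : 'M[R]_m) u v : bil (A *m T) u v = bil T (u *m A) v.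
Proof. by rewrite /bil !mulmxA. Qed.

Lemma bil_tr (T : 'M[R]_m) u v : bil T^T u v = bil T v u.
Proof.
by rewrite /bil -[LHS]trace_mx11 -mxtrace_tr !trmx_mul !trmxK trace_mx11 mulmxA.
Qed.

Lemma bilNm (T : 'M[R]_m) u v : bil (- T) u v = - bil T u v.
Proof. by rewrite /bil mulmxN mulNmx oppmxE. Qed.

Lemma bilAm (S T : 'M[R]_m) u v : bil (S + T) u v = bil S u v + bil T u v.
Proof. by rewrite -[S in LHS]scale1r bilDm mul1r. Qed.

Lemma bilAl (T : 'M[R]_m) u v w : bil T (u + v) w = bil T u w + bil T v w.
Proof. by rewrite /bil !mulmxDl addmxE. Qed.

Lemma bilNr (T : 'M[R]_m) u v : bil T u (- v) = - bil T u v.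
Proof. by rewrite /bil linearN mulmxN oppmxE. Qed.

Lemma bilNl (T : 'M[R]_m) u v : bil T (- u) v = - bil T u v.
Proof. by rewrite /bil !mulNmx oppmxE. Qed.

Lemma derive_bil_cst (T : 'rV[R]_m -> 'M[R]_m) u v w x : differentiable T x ->
  'D_w (fun y => bil (T y) u v) x = bil ('D_w T x) u v.
Proof.
move=> dT.
have d1 : differentiable (fun y => u *m T y) x.
  exact: differentiable_mulmx (differentiable_cst u x) dT.
have d2 : differentiable (fun y => u *m T y *m v^T) x.
  exact: differentiable_mulmx d1 (differentiable_cst v^T x).
by rewrite (derive_entry w 0 0 d2) derive_mulmxr // derive_mulmxl.
Qed.

Lemma derive_mxtrace (T : 'rV[R]_m -> 'M[R]_m) w x : differentiable T x ->
  'D_w (fun y => \tr (T y)) x = \tr ('D_w T x).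
Proof.
move=> dT.
have -> : (fun y => \tr (T y)) = \sum_k (fun y => T y k k).
  by apply/funext => y; rewrite fct_sumE.
rewrite derive_sum; last by move=> k; exact: derivable_entry.
by apply: eq_bigr => k _; exact: derive_entry.
Qed.

End Traces.

(** The four cyclic identities obtained by rotating (a, b, c, d), normalised by the two
    skew-symmetries, combine linearly to the claim. *)
Lemma pair_symmetry {R : realType} {T : Type} (f : T -> T -> T -> T -> R) :
  (forall a b c d, f b a c d = - f a b c d) ->
  (forall a b c d, f a b d c = - f a b c d) ->
  (forall a b c d, f a b c d + f b c a d + f c a b d = 0) ->
  forall a b c d, f a b c d = f c d a b.
Proof.
move=> s1 s2 B a b c d.
have := B a b c d; have := B b c d a; have := B c d a b; have := B d a b c.
rewrite (s2 b c a d) (s2 c d a b) (s1 b d c a) (s1 a d c b) (s2 a d b c).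
rewrite (s1 c a d b) (s2 c a b d) (s1 a d b c) (s2 a b c d) (s2 b d c a).
by lra.
Qed.

(** The first three hypotheses are the torsion-free condition differentiated, the last three the
    condition itself; they match the twelve terms in cancelling pairs. *)
Lemma bianchi1_algebra {R : realType} {m} (u v w : 'rV[R]_m)
    (DuAv DuAw DvAu DvAw DwAu DwAv Au Av Aw : 'M[R]_m) :
  w *m DuAv = v *m DuAw -> u *m DvAw = w *m DvAu -> v *m DwAu = u *m DwAv ->
  v *m Au = u *m Av -> w *m Av = v *m Aw -> u *m Aw = w *m Au ->
  w *m (DuAv - DvAu + Av *m Au - Au *m Av) + u *m (DvAw - DwAv + Aw *m Av - Av *m Aw)
  + v *m (DwAu - DuAw + Au *m Aw - Aw *m Au) = 0.
Proof.
move=> E1 E2 E3 E4 E5 E6.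
rewrite !(mulmxDr, mulmxN) !mulmxA E1 E2 E3 E4 E5 E6.
by apply/matrixP => i j; rewrite ?(addmxE, oppmxE) [RHS]mxE; ring.
Qed.

(** The dual connection - A^T has curvature minus the transpose of that of A. *)
Lemma trmx_curv_algebra {R : realType} {m} (a b c d : 'M[R]_m) :
  (a - b + c *m d - d *m c)^T =
  - (- a^T - (- b^T) + (- c^T) *m (- d^T) - (- d^T) *m (- c^T)).
Proof.
rewrite linearB /= linearD /= linearB /= !trmx_mul !mulmxN !mulNmx !opprK.
by mx_linear.
Qed.

Section ConnectionCurvature.
Context {R : realType} {m : nat} (U : set 'rV[R]_m) (G : 'rV[R]_m -> 'M[R]_m).
Context (oU : open U) (smoothG : smooth_on U G)
  (symG : forall y, U y -> (G y)^T = G y)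
  (unitG : forall y, U y -> G y \in unitmx).
Implicit Types (x u v w : 'rV[R]_m).
Local Notation Gamma := (conn G).
Local Notation Rm := (curv Gamma).

Lemma smooth_on_curv u v : smooth_on U (Rm u v).
Proof.
have sc a := smooth_on_conn a oU smoothG unitG.
have sN p q (f : 'rV[R]_m -> 'M[R]_(p, q)) : smooth_on U f ->
  smooth_on U (fun x => - f x).
  move=> sf; apply: (@smooth_on_eq _ _ _ (fun x => (-1) *: f x)) => //.
    by move=> x _; rewrite scaleN1r.
  by apply: smooth_on_scale => //; exact: smooth_on_cst.
apply: smooth_on_add => //; last by apply: sN; exact: smooth_on_mulmx.
apply: smooth_on_add => //; last exact: smooth_on_mulmx.
apply: smooth_on_add => //; first exact: smooth_on_derive.
by apply: sN; exact: smooth_on_derive.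
Qed.

Lemma smooth_on_ricci : smooth_on U (ricci G).
Proof.
apply/smooth_on_mxP => // a b.
apply: (@smooth_on_eq _ _ _ (fun x => \sum_k (((delta_mx 0 b : 'rV[R]_m) *m
    Rm (delta_mx 0 k) (delta_mx 0 a) x) 0 k))) => //.
  move=> x; rewrite inE => Ux; rewrite mxE; apply: eq_bigr => k _.
  by rewrite (curvature_conn _ _ _ oU smoothG unitG Ux).
apply: smooth_on_sum => // k _; apply: (smooth_on_mxP _ oU).1.
by apply: smooth_on_mulmx => //; [exact: smooth_on_cst|exact: smooth_on_curv].
Qed.

Section Pointwise.
Context (x : 'rV[R]_m) (Ux : U x).

Lemma differentiable_conn u : differentiable (Gamma u) x.
Proof. exact: smooth_on_diff (smooth_on_conn u oU smoothG unitG) Ux. Qed.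

Lemma conn_symU u v y : U y -> v *m Gamma u y = u *m Gamma v y.
Proof.
by move=> Uy; apply: conn_sym oU Uy (smooth_on_diff smoothG Uy) symG.
Qed.

Lemma bianchi1 u v w : w *m Rm u v x + u *m Rm v w x + v *m Rm w u x = 0.
Proof.
have P a b c : a *m 'D_b (Gamma c) x = c *m 'D_b (Gamma a) x.
  rewrite -!derive_mulmxl; [|exact: differentiable_conn|exact: differentiable_conn].
  by apply: derive_eq_on_open oU Ux _ => y; exact: conn_symU.
exact: bianchi1_algebra (P w u v) (P u v w) (P v w u)
  (conn_symU u v Ux) (conn_symU v w Ux) (conn_symU w u Ux).
Qed.

(** Metricity says that [G] intertwines [Gamma] with its dual - Gamma^T, so [gauge_curv] with K = G
    compares the curvature with that of the dual connection. *)
Lemma curv_skew u v : Rm u v x *m G x = - (G x *m (Rm u v x)^T).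
Proof.
pose B a y := - (Gamma a y)^T.
have dT a : differentiable (fun y => (Gamma a y)^T) x.
  exact: differentiable_trmx (differentiable_conn a).
have dB a : differentiable (B a) x by exact: differentiableN (dT a).
have -> : (Rm u v x)^T = - curv B u v x.
  have DB a b : 'D_b (B a) x = - ('D_b (Gamma a) x)^T.
    by rewrite derive_oppmx // derive_trmx //; exact: differentiable_conn.
  by rewrite /curv !DB; exact: trmx_curv_algebra.
rewrite mulmxN opprK; apply: esym.
apply: (gauge_curv u v oU Ux smoothG dB differentiable_conn) => a y Uy.
rewrite (conn_metric a oU Uy (smooth_on_diff smoothG Uy) symG (unitG Uy)).
by rewrite /B mulmxN addrC addrK.
Qed.

(** By [curv_skew] the curvature is conjugate, through the metric, to minus its transpose. *)
Lemma curv_trace0 u v : \tr (Rm u v x) = 0.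
Proof.
have : \tr (Rm u v x) = - \tr (Rm u v x).
  rewrite -{1}(mulmxK (unitG Ux) (Rm u v x)) curv_skew mulNmx linearN /=.
  by rewrite mxtrace_mulC mulmxA mulVmx ?unitG // mul1mx mxtrace_tr.
move: (\tr _) => t; lra.
Qed.

Lemma curv_pair_symmetry u v w w' :
  bil (G x) (w *m Rm u v x) w' = bil (G x) (u *m Rm w w' x) v.
Proof.
pose f a b c d := bil (G x) (c *m Rm a b x) d.
apply: (@pair_symmetry _ _ f) => a b c d; rewrite /f.
- by rewrite curvC mulmxN bilNl.
- rewrite -[LHS]bil_mull curv_skew bilNm bil_mulr; congr (- _).
  by apply: bil_sym; exact: symG.
- by rewrite -!bilAl bianchi1 /bil !mul0mx mxE.
Qed.

(** Tracing the first Bianchi identity shows that Ric(u, v) - Ric(v, u) is the trace of the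
    endomorphism R(v, u), which vanishes. *)
Lemma ricci_sym u v : bil (ricci G x) u v = bil (ricci G x) v u.
Proof.
rewrite !(bil_ricci _ _ oU smoothG unitG Ux); apply/eqP; rewrite -subr_eq0; apply/eqP.
rewrite -[RHS](curv_trace0 v u) -row_trace -sumrB; apply: eq_bigr => k _.
have /(congr1 (fun M : 'rV[R]_m => M 0 k)) := bianchi1 (delta_mx 0 k) u v.
rewrite (curvC Gamma v (delta_mx 0 k)) (curvC Gamma u v) !mulmxN !addmxE
  !oppmxE zeromxE.
move: ((v *m _) 0 k) ((u *m _) 0 k) ((_ *m Rm v u x) 0 k) => a b c; lra.
Qed.

End Pointwise.
End ConnectionCurvature.

(** * Second Bianchi identity and Kaehler metrics *)

(** [A], [B], [C] are the connection matrices of three directions a, b, c; a lower-case suffix lists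
    derivatives, outermost first, so that [Abc] is D_b D_c A. The last three hypotheses are the
    symmetry of second derivatives. *)
Lemma bianchi2_algebra {R : realType} {m} (A B C DcF DaF DbF : 'M[R]_m)
    (Ab Ac Ba Bc Ca Cb Abc Acb Bac Bca Cab Cba : 'M[R]_m) :
  let F a b (ab ba : 'M[R]_m) := ba - ab + b *m a - a *m b in
  DcF = Bca - Acb + (Bc *m A + B *m Ac) - (Ac *m B + A *m Bc) ->
  DaF = Cab - Bac + (Ca *m B + C *m Ba) - (Ba *m C + B *m Ca) ->
  DbF = Abc - Cba + (Ab *m C + A *m Cb) - (Cb *m A + C *m Ab) ->
  Abc = Acb -> Bac = Bca -> Cab = Cba ->
  (DcF + F A B Ab Ba *m C - C *m F A B Ab Ba)
  + (DaF + F B C Bc Cb *m A - A *m F B C Bc Cb)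
  + (DbF + F C A Ca Ac *m B - B *m F C A Ca Ac) = 0.
Proof.
move=> F -> -> -> -> -> ->; rewrite /F !(mulmxDl, mulmxDr, mulNmx, mulmxN) !mulmxA.
by apply/matrixP => i j; rewrite ?(addmxE, oppmxE) zeromxE; ring.
Qed.

Section SecondBianchi.
Context {R : realType} {m : nat} (U : set 'rV[R]_m)
  (A : 'rV[R]_m -> 'rV[R]_m -> 'M[R]_m).
Context (oU : open U) (sA : forall a, smooth_on U (A a)) (x : 'rV[R]_m) (Ux : U x).

Lemma derive_curv u v w : 'D_w (curv A u v) x =
  'D_w ('D_u (A v)) x - 'D_w ('D_v (A u)) x
  + ('D_w (A v) x *m A u x + A v x *m 'D_w (A u) x)
  - ('D_w (A u) x *m A v x + A u x *m 'D_w (A v) x).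
Proof.
have dA a : differentiable (A a) x by exact: smooth_on_diff (sA a) Ux.
have dD a b : differentiable ('D_a (A b)) x.
  exact: smooth_on_diff (smooth_on_derive a (sA b)) Ux.
have dM a b : differentiable (fun y => A a y *m A b y) x.
  exact: differentiable_mulmx.
have dN (f : 'rV[R]_m -> 'M[R]_m) : differentiable f x -> differentiable
  (fun y => - f y) x.
  exact: differentiableN.
have dP (f g : 'rV[R]_m -> 'M[R]_m) : differentiable f x -> differentiable g x ->
    differentiable (fun y => f y + g y) x.
  exact: differentiableD.
have d1 := dP _ _ (dD u v) (dN _ (dD v u)).
have d2 := dP _ _ d1 (dM v u).
apply: etrans (derive_addmx w d2 (dN _ (dM u v))) _.
rewrite (derive_oppmx w (dM u v)) (derive_mulmx w (dA u) (dA v)); congr (_ - _).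
apply: etrans (derive_addmx w d1 (dM v u)) _.
rewrite (derive_mulmx w (dA v) (dA u)); congr (_ + _).
apply: etrans (derive_addmx w (dD u v) (dN _ (dD v u))) _.
by rewrite (derive_oppmx w (dD v u)).
Qed.

(** The identity d_A F = 0 for an arbitrary matrix-valued connection: each summand is the covariant
    derivative of the curvature as an endomorphism, its two direction slots being held constant. *)
Lemma bianchi2 u v w :
  ('D_w (curv A u v) x + curv A u v x *m A w x - A w x *m curv A u v x)
  + ('D_u (curv A v w) x + curv A v w x *m A u x - A u x *m curv A v w x)
  + ('D_v (curv A w u) x + curv A w u x *m A v x - A v x *m curv A w u x) = 0.
Proof.
exact: bianchi2_algebra (derive_curv u v w) (derive_curv v w u) (derive_curv w u v)
  (derive_comm v w oU (sA u) Ux) (derive_comm u w oU (sA v) Ux)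
  (derive_comm u v oU (sA w) Ux).
Qed.

End SecondBianchi.

(** With D_c J = C J - J C, where C is the connection matrix, the product rule for tr (J S) becomes
    the trace of J against the covariant derivative of S; cyclicity of the trace moves the
    commutator from J to S. *)
Lemma trace_commutator {R : realType} {m} (J C S T : 'M[R]_m) :
  \tr ((C *m J - J *m C) *m S + J *m T) = \tr (J *m (T + S *m C - C *m S)).
Proof.
rewrite mulmxBl mulmxBr mulmxDr mxtraceD linearB /= [RHS]linearB /= mxtraceD.
rewrite !mulmxA -[C *m J *m S]mulmxA [\tr (C *m _)]mxtrace_mulC.
by rewrite addrAC [X in X - _]addrC.
Qed.

Lemma trace_sum_eq0 {R : realType} {m} (c : R) (J S T V : 'M[R]_m) : S + T + V = 0 ->
  c * \tr (J *m S) + c * \tr (J *m T) + c * \tr (J *m V) = 0.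
Proof.
by move=> E; rewrite -!mulrDr -!mxtraceD -!mulmxDr E mulmx0 mxtrace0 mulr0.
Qed.

Section KaehlerChart.
Context {R : realType} {m : nat} (U : set 'rV[R]_m) (G J : 'rV[R]_m -> 'M[R]_m).
Context (oU : open U) (smoothG : smooth_on U G)
  (symG : forall y, U y -> (G y)^T = G y)
  (unitG : forall y, U y -> G y \in unitmx)
  (smoothJ : smooth_on U J)
  (J2 : forall y, U y -> J y *m J y = - 1%:M)
  (hermG : forall y, U y -> J y *m G y *m (J y)^T = G y)
  (parJ : forall a y, U y -> J y *m conn G a y + 'D_a J y = conn G a y *m J y).
Implicit Types (x u v w : 'rV[R]_m).
Local Notation Gamma := (conn G).
Local Notation Rm := (curv Gamma).
Local Notation omega := (fun y => G y *m (J y)^T).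
Local Notation rho := (fun y => ricci G y *m (J y)^T).

Let smoothC a : smooth_on U (Gamma a).
Proof. exact: smooth_on_conn. Qed.

Section Pointwise.
Context (x : 'rV[R]_m) (Ux : U x).

Let JJ u : u *m J x *m J x = - u.
Proof. by rewrite -mulmxA J2 // mulmxN mulmx1. Qed.

(** Parallelism of J is exactly the gauge relation with K = J and the same connection on both
    sides. *)
Lemma curv_J u v : Rm u v x *m J x = J x *m Rm u v x.
Proof.
have dC a : differentiable (Gamma a) x by exact: smooth_on_diff (smoothC a) Ux.
by rewrite -(gauge_curv u v oU Ux smoothJ dC dC).
Qed.

Lemma bil_JJ u v : bil (G x) (u *m J x) (v *m J x) = bil (G x) u v.
Proof. by rewrite -bil_mull -bil_mulr hermG. Qed.

Lemma omega_skew u v : bil (G x) u (v *m J x) = - bil (G x) v (u *m J x).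
Proof.
by rewrite -[LHS]bil_JJ JJ bilNr; congr (- _); apply: bil_sym; exact: symG.
Qed.

(** Pair symmetry transfers the invariance to the other two slots, where it follows from [curv_J]
    and the hermitian property. *)
Lemma curv_JJ u v : Rm (u *m J x) (v *m J x) x = Rm u v x.
Proof.
have pair := curv_pair_symmetry oU smoothG symG unitG Ux.
suff E : Rm (u *m J x) (v *m J x) x *m G x = Rm u v x *m G x.
  by rewrite -[LHS](mulmxK (unitG Ux)) E mulmxK // unitG.
apply: bil_inj => a b; rewrite !bil_mull pair [RHS]pair.
by rewrite -mulmxA -curv_J mulmxA bil_JJ.
Qed.

(** [curv_J] takes J out of the vector acted on, the trace carries it to the summed direction, and
    [curv_JJ] removes it there together with the J on [u]. *)
Lemma ricci_JJ u v : bil (ricci G x) (u *m J x) (v *m J x) = bil (ricci G x) u v.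
Proof.
rewrite !(bil_ricci _ _ oU smoothG unitG Ux).
have lf : linear (fun w => v *m Rm w (u *m J x) x).
  move=> a w w'; rewrite curv_linearl.
  - by rewrite mulmxDr scalemxAr.
  - exact: conn_linear.
  - by move=> b; exact: differentiable_conn Ux b.
under eq_bigr do rewrite -mulmxA -curv_J mulmxA.
rewrite -(row_trace_comm (J x) lf).
by under eq_bigr do rewrite curv_JJ.
Qed.

Lemma rho_skew u v : bil (rho x) u v = - bil (rho x) v u.
Proof.
rewrite !bil_mulr -[LHS]ricci_JJ JJ bilNr (ricci_sym oU smoothG symG unitG Ux).
by [].
Qed.

(* This expression of the Ricci form through the curvature 2-form reduces its
   closedness to the second Bianchi identity. *)
Lemma rho_trace u v : bil (rho x) u v = - 2^-1 * \tr (J x *m Rm u v x).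
Proof.
have dC := differentiable_conn oU smoothG unitG Ux.
have lf a (b : 'rV[R]_m) : linear (fun w => b *m Rm w a x).
  move=> c w w'; rewrite curv_linearl //; last exact: conn_linear.
  by rewrite mulmxDr scalemxAr.
have T a b : \sum_k (b *m Rm (delta_mx 0 k *m J x) a x) 0 k = bil (rho x) a b.
  rewrite (row_trace_comm (J x) (lf a b)) bil_mulr (bil_ricci _ _ oU
    smoothG unitG Ux).
  by apply: eq_bigr => k _; rewrite -!mulmxA curv_J.
(* The first Bianchi identity for [u], [v] and e_k J, traced over k. Skew-symmetry of rho merges its
   two terms, whence the factor 1/2. *)
have : \tr (J x *m Rm u v x) - bil (rho x) v u + bil (rho x) u v = 0.
  rewrite -row_trace -!T -sumrB -big_split /= big1 // => k _.
  have /(congr1 (fun M : 'rV[R]_m => M 0 k)) :=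
    bianchi1 oU smoothG symG unitG Ux u v (delta_mx 0 k *m J x).
  by rewrite (curvC Gamma v) mulmxN !addmxE oppmxE zeromxE mulmxA.
rewrite (rho_skew v u).
move: (bil _ _ _) (\tr _) => b t; lra.
Qed.

End Pointwise.

Lemma smooth_on_rho : smooth_on U rho.
Proof.
by apply: smooth_on_mulmx => //; [exact: smooth_on_ricci|exact: smooth_on_trmx].
Qed.

Lemma smooth_on_omega : smooth_on U omega.
Proof. by apply: smooth_on_mulmx => //; exact: smooth_on_trmx. Qed.

Lemma derive_rho_cyclic x u v w : U x ->
  bil ('D_w rho x) u v + bil ('D_u rho x) v w + bil ('D_v rho x) w u = 0.
Proof.
move=> Ux.
have dJ : differentiable J x by exact: smooth_on_diff smoothJ Ux.
have D a b c : bil ('D_c rho x) a b = - 2^-1 *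
    \tr (J x *m ('D_c (Rm a b) x + Rm a b x *m Gamma c x - Gamma c x *m Rm a b x)).
  rewrite -(derive_bil_cst _ _ _ (smooth_on_diff smooth_on_rho Ux)).
  have dR : differentiable (Rm a b) x.
    exact: smooth_on_diff (smooth_on_curv oU smoothG unitG a b) Ux.
  have dT : differentiable (fun y => J y *m Rm a b y) x.
    exact: differentiable_mulmx dJ dR.
  rewrite (derive_eq_on_open _ oU Ux (fun y Uy => rho_trace Uy a b)).
  have dt : derivable (fun y => \tr (J y *m Rm a b y)) x c.
    have -> : (fun y => \tr (J y *m Rm a b y)) =
        \sum_k (fun y => (J y *m Rm a b y) k k).
      by apply/funext => y; rewrite fct_sumE.
    by apply: derivable_sum => k; exact: derivable_entry.
  apply: etrans (deriveZ (- 2^-1) dt) _; congr (_ * _).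
  rewrite derive_mxtrace // derive_mulmx //.
  have -> : 'D_c J x = Gamma c x *m J x - J x *m Gamma c x.
    by rewrite -(parJ c Ux) addrAC subrr add0r.
  exact: trace_commutator.
apply: etrans (congr2 +%R (congr2 +%R (D u v w) (D v w u)) (D w u v)) _.
exact/trace_sum_eq0/(bianchi2 oU smoothC Ux).
Qed.

Lemma derive_omega c x : U x ->
  'D_c omega x = Gamma c x *m omega x + omega x *m (Gamma c x)^T.
Proof.
move=> Ux.
have dJ : differentiable J x by exact: smooth_on_diff smoothJ Ux.
have dG : differentiable G x by exact: smooth_on_diff smoothG Ux.
rewrite (derive_mulmx c dG (differentiable_trmx dJ)) (derive_trmx c dJ).
rewrite (conn_metric c oU Ux dG symG (unitG Ux)).
have -> : 'D_c J x = Gamma c x *m J x - J x *m Gamma c x.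
  by rewrite -(parJ c Ux) addrAC subrr add0r.
by rewrite linearB /= !trmx_mul mulmxDl mulmxBr !mulmxA addrA [_ + _ - _]addrAC addrK.
Qed.

(** Parallelism replaces the derivatives by six connection terms, which cancel in pairs by the
    symmetry of the connection and the skew-symmetry of omega. *)
Lemma derive_omega_cyclic x u v w : U x ->
  bil ('D_w omega x) u v + bil ('D_u omega x) v w + bil ('D_v omega x) w u = 0.
Proof.
move=> Ux.
have D a b c : bil ('D_c omega x) a b =
    bil (omega x) (a *m Gamma c x) b + bil (omega x) a (b *m Gamma c x).
  by rewrite derive_omega // bilAm bil_mull -bil_mulr.
have S a b : bil (omega x) a b = - bil (omega x) b a.
  by rewrite !bil_mulr; exact: omega_skew.
have C a b : a *m Gamma b x = b *m Gamma a x.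
  exact: conn_symU oU smoothG symG _ _ _ Ux.
apply: etrans (congr2 +%R (congr2 +%R (D u v w) (D v w u)) (D w u v)) _.
rewrite (C u w) (C v w) (C u v) (S u) (S v) (S w).
move: (bil _ _ _) (bil _ _ _) (bil _ _ _) => b1 b2 b3; ring.
Qed.

End KaehlerChart.

(** * Naturality of the Ricci tensor *)

Section ChainRules.
Context {R : realType} {m k : nat}.

Lemma differentiable_scalemx {p q} (f : 'rV[R]_m -> R)
    (M : 'rV[R]_m -> 'M[R]_(p, q)) x :
  differentiable f x -> differentiable M x ->
  differentiable (fun y => f y *: M y) x.
Proof.
move=> df dM; apply/differentiable_mxP => i j; under eq_fun do rewrite mxE.
by apply: differentiableM => //; apply: (differentiable_mxP _ _).1.
Qed.

Lemma derive_scalemx {p q} (f : 'rV[R]_m -> R) (M : 'rV[R]_m -> 'M[R]_(p, q)) u x :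
  differentiable f x -> differentiable M x ->
  'D_u (fun y => f y *: M y) x = 'D_u f x *: M x + f x *: 'D_u M x.
Proof.
move=> df dM; have dfM := differentiable_scalemx df dM.
apply/matrixP => i j.
apply: etrans (esym (derive_entry u i j dfM)) _.
have -> : (fun y => (f y *: M y) i j) = f * (fun y => M y i j).
  by apply/funext => y; rewrite mxE.
rewrite deriveM; [|exact: diff_derivable|exact: derivable_entry].
rewrite (derive_entry u i j dM) addmxE !scalemxE addrC; congr (_ + _).
by rewrite [LHS]mulrC.
Qed.

Lemma derive_compose {W : normedModType R} (F : 'rV[R]_m -> 'rV[R]_k)
    (H : 'rV[R]_k -> W) u x :
  differentiable F x -> differentiable H (F x) ->
  'D_u (fun y => H (F y)) x = 'D_('D_u F x) H (F x).
Proof.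
move=> dF dH; rewrite (deriveE _ dH) (deriveE _ dF).
have dHF : differentiable (H \o F) x by exact: differentiable_comp.
by rewrite -[LHS]/('D_u (H \o F) x) (deriveE _ dHF) diff_comp.
Qed.

(** A chain rule for a family whose linear argument also moves with the point, as the direction a
    K(y) of a pulled-back connection does. Expanding that argument in coordinates reduces it to the
    differentiability of each [C a]. *)
Lemma derive_family {p q} (C : 'rV[R]_k -> 'rV[R]_k -> 'M[R]_(p, q))
    (h F : 'rV[R]_m -> 'rV[R]_k) u x :
  (forall y, linear (C^~ y)) -> (forall a, differentiable (C a) (F x)) ->
  differentiable h x -> differentiable F x ->
  differentiable (fun y => C (h y) (F y)) x /\
  'D_u (fun y => C (h y) (F y)) x =
    C ('D_u h x) (F x) + 'D_('D_u F x) (C (h x)) (F x).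
Proof.
move=> lC dC dh dF.
have E y : C (h y) (F y) = \sum_c h y 0 c *: C (delta_mx 0 c) (F y).
  by rewrite (linear_rowE (h y) (lC (F y))).
have dhc c : differentiable (fun y => h y 0 c) x by apply: (differentiable_mxP _ _).1.
have dCF c : differentiable (fun y => C (delta_mx 0 c) (F y)) x.
  by apply: (@differentiable_comp _ _ _ _ F (C (delta_mx 0 c))).
have dM c : differentiable (fun y => h y 0 c *: C (delta_mx 0 c) (F y)) x.
  exact: differentiable_scalemx.
have -> : (fun y => C (h y) (F y)) =
    \sum_c (fun y => h y 0 c *: C (delta_mx 0 c) (F y)).
  by apply/funext => y; rewrite E fct_sumE.
split; first exact: differentiable_sum.
rewrite derive_sum; last by move=> c; exact: diff_derivable.
rewrite (linear_rowE ('D_u h x) (lC (F x))).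
have -> : C (h x) = \sum_c (h x 0 c \*: C (delta_mx 0 c)).
  by apply/funext => y; rewrite fct_sumE (linear_rowE (h x) (lC y)).
rewrite derive_sum; last by move=> c; exact/derivableZ/diff_derivable.
rewrite -big_split /=; apply: eq_bigr => c _.
rewrite (derive_scalemx u (dhc c) (dCF c)) (derive_entry u 0 c dh).
rewrite (derive_compose u dF (dC _)) deriveZ //.
exact: diff_derivable.
Qed.

End ChainRules.

Section Naturality.
Context {R : realType} {m : nat} (U V : set 'rV[R]_m) (F : 'rV[R]_m -> 'rV[R]_m)
  (G H : 'rV[R]_m -> 'M[R]_m).
Context (oU : open U) (oV : open V) (smoothF : smooth_on U F)
  (smoothG : smooth_on U G) (smoothH : smooth_on V H)
  (symG : forall y, U y -> (G y)^T = G y) (symH : forall y, V y -> (H y)^T = H y)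
  (unitG : forall y, U y -> G y \in unitmx) (unitH : forall y, V y -> H y \in unitmx)
  (FV : forall y, U y -> V (F y)) (unitF : forall y, U y -> 'J F y \in unitmx)
  (pullG : forall y, U y -> G y = 'J F y *m H (F y) *m ('J F y)^T).
Local Notation K := (jacobian F).

Let dF y : U y -> differentiable F y. Proof. exact: smooth_on_diff smoothF. Qed.

Let mulmx_jacobian u y : differentiable F y -> u *m K y = 'D_u F y.
Proof. by move=> dFy; rewrite deriveEjacobian. Qed.

Lemma smooth_on_jacobian : smooth_on U K.
Proof.
apply/smooth_on_mxP => // i j.
apply: (@smooth_on_eq _ _ _ (fun y => ('D_(delta_mx 0 i) F y) 0 j)) => //.
  move=> y; rewrite inE => Uy.
  by rewrite -(mulmx_jacobian _ (dF Uy)) -rowE mxE.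
by apply: (smooth_on_mxP _ oU).1; exact: smooth_on_derive.
Qed.

Let dK y : U y -> differentiable K y.
Proof. exact: smooth_on_diff smooth_on_jacobian. Qed.

Lemma jacobian_sym u v x : U x -> v *m 'D_u K x = u *m 'D_v K x.
Proof.
move=> Ux; rewrite -(derive_mulmxl v u (dK Ux)) -(derive_mulmxl u v (dK Ux)).
rewrite (derive_eq_on_open u oU Ux (fun y Uy => mulmx_jacobian v (dF Uy))).
rewrite (derive_eq_on_open v oU Ux (fun y Uy => mulmx_jacobian u (dF Uy))).
exact: derive_comm oU smoothF Ux.
Qed.

(** The connection of [H] pulled back along [F]. *)
Let A a y := conn H (a *m K y) (F y).

Let dA a u x : U x -> differentiable (A a) x /\
  'D_u (A a) x =
    conn H (a *m 'D_u K x) (F x) + 'D_(u *m K x) (conn H (a *m K x)) (F x).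
Proof.
move=> Ux; rewrite -(derive_mulmxl a u (dK Ux)) (mulmx_jacobian u (dF Ux)).
apply: derive_family.
- by move=> y; exact: conn_linear.
- by move=> b; exact: smooth_on_diff (smooth_on_conn b oV smoothH unitH) (FV Ux).
- exact: differentiable_mulmx (differentiable_cst a x) (dK Ux).
- exact: dF.
Qed.

(** The transformation law of Christoffel symbols, by uniqueness: the candidate (K A_u + D_u K) K^-1
    is symmetric because second derivatives of [F] commute, and compatible with [G] by
    differentiating [pullG]. It says that the Jacobian is parallel between the two connections. *)
Lemma conn_jacobian a x : U x -> K x *m A a x + 'D_a K x = conn G a x *m K x.
Proof.
move=> Ux; pose B u := (K x *m A u x + 'D_u K x) *m invmx (K x).
suff -> : conn G a x = B a by rewrite mulmxKV // unitF.
have dG := smooth_on_diff smoothG Ux.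
have dH := smooth_on_diff smoothH (FV Ux).
have dHF : differentiable (fun y => H (F y)) x.
  exact: (@differentiable_comp _ _ _ _ F H _ (dF Ux) dH).
have BG u : B u *m G x = (K x *m A u x + 'D_u K x) *m H (F x) *m (K x)^T.
  by rewrite pullG // /B !mulmxA mulmxKV // unitF.
apply: (@conn_unique _ _ G x B _ dG (symG Ux) (unitG Ux)).
- move=> b u v; rewrite /B scalemxAl -mulmxDl; congr (_ *m _).
  rewrite (derive_dir_linear (dK Ux)) /A mulmxDl -scalemxAl conn_linear.
  rewrite mulmxDr -scalemxAr scalerDr.
  move: (_ *m _) (_ *m _) ('D_u _ x) ('D_v _ x) => ? ? ? ?; by mx_linear.
- move=> u v; rewrite /B !mulmxA !mulmxDr !mulmxA (jacobian_sym u v Ux).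
  by rewrite (conn_sym _ _ oV (FV Ux) dH symH).
- move=> u; have -> : G x *m (B u)^T = (B u *m G x)^T by rewrite [RHS]trmx_mul symG.
  rewrite BG (derive_eq_on_open u oU Ux pullG).
  have d1 := differentiable_mulmx (dK Ux) dHF.
  rewrite (derive_mulmx u d1 (differentiable_trmx (dK Ux))) (derive_mulmx u
    (dK Ux) dHF).
  rewrite (derive_trmx u (dK Ux)) (derive_compose u (dF Ux) dH).
  rewrite -(mulmx_jacobian u (dF Ux)) (conn_metric _ oV (FV Ux) dH symH
    (unitH (FV Ux))).
  rewrite -/(A u x) !trmx_mul [(_ + _)^T]linearD /= trmxK trmx_mul (symH (FV Ux)).
  rewrite !(mulmxDl, mulmxDr) !mulmxA.
  move: ('D_u K x) => DK; by mx_linear.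
Qed.

Lemma curv_jacobian u v x : U x ->
  K x *m curv (conn H) (u *m K x) (v *m K x) (F x) = curv (conn G) u v x *m K x.
Proof.
move=> Ux.
have dA' a : differentiable (A a) x by have [] := dA a 0 Ux.
have dC a : differentiable (conn G a) x.
  exact: smooth_on_diff (smooth_on_conn a oU smoothG unitG) Ux.
(* The directions u K(y) vary with y, but the terms in D K that this produces cancel by
   [jacobian_sym]. *)
have <- : curv A u v x = curv (conn H) (u *m K x) (v *m K x) (F x).
  apply: etrans (congr2 (fun a b => a - b + A v x *m A u x - A u x *m A v x)
    (dA v u Ux).2 (dA u v Ux).2) _.
  rewrite (jacobian_sym u v Ux); congr (_ + _ - _).
  by rewrite opprD addrACA subrr add0r.
have E a y : U y -> K y *m A a y + 'D_a K y = conn G a y *m K y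
  by move=> /conn_jacobian.
exact: (@gauge_curv _ _ _ _ U K A (conn G) u v x oU Ux smooth_on_jacobian dA' dC E).
Qed.

Lemma ricci_natural x : U x -> ricci G x = K x *m ricci H (F x) *m (K x)^T.
Proof.
move=> Ux; apply: bil_inj => u v; rewrite bil_mulr bil_mull.
rewrite (bil_ricci _ _ oU smoothG unitG Ux) (bil_ricci _ _ oV smoothH unitH (FV Ux)).
have [L fL] : exists L : 'M[R]_m, forall w,
    v *m K x *m curv (conn H) w (u *m K x) (F x) = w *m L.
  apply: linear_mulmx_ex => a w w'; rewrite curv_linearl.
  - by rewrite mulmxDr scalemxAr.
  - by move=> y; exact: conn_linear.
  - by move=> b; exact: smooth_on_diff (smooth_on_conn b oV smoothH unitH) (FV Ux).
under [RHS]eq_bigr do rewrite fL; rewrite row_trace.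
(* The trace of [L] equals that of its conjugate K L K^-1, which is the endomorphism traced on the
   side of [G]. *)
rewrite -[L in RHS]mul1mx -(mulVmx (unitF Ux)) -mulmxA mxtrace_mulC -row_trace.
apply: eq_bigr => k _; congr (fun_of_matrix _ 0 k).
rewrite !mulmxA -fL -[in LHS](mulmxK (unitF Ux) (curv _ _ _ _)).
by rewrite -curv_jacobian // !mulmxA.
Qed.

End Naturality.

(** * The lifted metric in a chart *)

Section BlockCalculus.
Context {R : realType} {k m : nat}.
Implicit Types (U : set 'rV[R]_m) (z u : 'rV[R]_(k + m)).

(** With constant matrices as the only block data, smoothness and derivatives of block matrices
    follow from those of sums and products. *)
Lemma block_mx_sum {p1 p2 q1 q2} (a : 'M[R]_(p1, q1)) (b : 'M[R]_(p1, q2))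
    (c : 'M[R]_(p2, q1)) (d : 'M[R]_(p2, q2)) :
  block_mx a b c d =
  col_mx 1%:M 0 *m (a *m row_mx 1%:M 0 + b *m row_mx 0 1%:M)
  + col_mx 0 1%:M *m (c *m row_mx 1%:M 0 + d *m row_mx 0 1%:M).
Proof.
rewrite !mul_mx_row !mulmx1 !mulmx0 !add_row_mx !add0r !addr0.
by rewrite !mul_col_mx !mul1mx !mul0mx add_col_mx add0r addr0.
Qed.

Lemma smooth_on_block_mx {n p1 p2 q1 q2} (V : set 'rV[R]_n)
    (a : 'rV[R]_n -> 'M[R]_(p1, q1)) (b : 'rV[R]_n -> 'M[R]_(p1, q2))
    (c : 'rV[R]_n -> 'M[R]_(p2, q1)) (d : 'rV[R]_n -> 'M[R]_(p2, q2)) :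
  open V -> smooth_on V a -> smooth_on V b -> smooth_on V c -> smooth_on V d ->
  smooth_on V (fun x => block_mx (a x) (b x) (c x) (d x)).
Proof.
move=> oV sa sb sc sd; under eq_fun do rewrite block_mx_sum.
have L p q r (C : 'M[R]_(p, q)) (f : 'rV[R]_n -> 'M[R]_(q, r)) :
    smooth_on V f -> smooth_on V (fun x => C *m f x).
  by move=> sf; apply: smooth_on_mulmx => //; exact: smooth_on_cst.
have S p q r (f : 'rV[R]_n -> 'M[R]_(p, q)) (C : 'M[R]_(q, r)) :
    smooth_on V f -> smooth_on V (fun x => f x *m C).
  by move=> sf; apply: smooth_on_mulmx => //; exact: smooth_on_cst.
by apply: smooth_on_add => //; apply: L; apply: smooth_on_add => //; apply: S.
Qed.

Lemma derive_block_mx {n p1 p2 q1 q2} (x v : 'rV[R]_n)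
    (a : 'rV[R]_n -> 'M[R]_(p1, q1)) (b : 'rV[R]_n -> 'M[R]_(p1, q2))
    (c : 'rV[R]_n -> 'M[R]_(p2, q1)) (d : 'rV[R]_n -> 'M[R]_(p2, q2)) :
  differentiable a x -> differentiable b x -> differentiable c x ->
    differentiable d x ->
  differentiable (fun y => block_mx (a y) (b y) (c y) (d y)) x /\
  'D_v (fun y => block_mx (a y) (b y) (c y) (d y)) x =
    block_mx ('D_v a x) ('D_v b x) ('D_v c x) ('D_v d x).
Proof.
move=> da db dc dd.
have L p q r (C : 'M[R]_(p, q)) (f : 'rV[R]_n -> 'M[R]_(q, r)) :
    differentiable f x -> differentiable (fun y => C *m f y) x.
  by move=> df; exact: differentiable_mulmx (differentiable_cst C x) df.
have S p q r (f : 'rV[R]_n -> 'M[R]_(p, q)) (C : 'M[R]_(q, r)) :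
    differentiable f x -> differentiable (fun y => f y *m C) x.
  by move=> df; exact: differentiable_mulmx df (differentiable_cst C x).
have T p q1' q2' r (f : 'rV[R]_n -> 'M[R]_(p, q1')) (h : 'rV[R]_n -> 'M[R]_(p, q2'))
    (C : 'M[R]_(q1', r)) (D : 'M[R]_(q2', r)) :
    differentiable f x -> differentiable h x ->
    differentiable (fun y => f y *m C + h y *m D) x /\
    'D_v (fun y => f y *m C + h y *m D) x = 'D_v f x *m C + 'D_v h x *m D.
  move=> df dh; split; first exact: differentiableD (S _ _ _ _ C df) (S _ _ _ _ D dh).
  rewrite (derive_addmx v (S _ _ _ _ C df) (S _ _ _ _ D dh)).
  by rewrite (derive_mulmxr C v df) (derive_mulmxr D v dh).
have E : (fun y => block_mx (a y) (b y) (c y) (d y)) = (fun y =>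
  col_mx 1%:M 0 *m (a y *m row_mx 1%:M 0 + b y *m row_mx 0 1%:M)
  + col_mx 0 1%:M *m (c y *m row_mx 1%:M 0 + d y *m row_mx 0 1%:M)).
  by apply/funext => y; exact: block_mx_sum.
have [dab Dab] := T _ _ _ _ _ _ (row_mx 1%:M 0) (row_mx 0 1%:M) da db.
have [dcd Dcd] := T _ _ _ _ _ _ (row_mx 1%:M 0) (row_mx 0 1%:M) dc dd.
rewrite E block_mx_sum; split.
  exact: differentiableD (L _ _ _ _ _ dab) (L _ _ _ _ _ dcd).
rewrite (derive_addmx v (L _ _ _ _ _ dab) (L _ _ _ _ _ dcd)).
by rewrite (derive_mulmxl _ v dab) (derive_mulmxl _ v dcd) Dab Dcd.
Qed.

Lemma open_rsubmx U : open U -> open (rsubmx @^-1` U : set 'rV[R]_(k + m)).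
Proof. by move=> oU; apply: open_comp => // z _; exact: continuous_rsubmx. Qed.

Lemma smooth_on_rsubmx {W : normedModType R} U (f : 'rV[R]_m -> W) : open U ->
  smooth_on U f ->
  smooth_on (rsubmx @^-1` U) (fun z : 'rV[R]_(k + m) => f (rsubmx z)).
Proof.
move=> oU sf.
pose P : {linear 'rV[R]_(k + m) -> 'rV[R]_m} := rsubmx.
pose Q : {linear W -> W} := idfun.
have Pc : continuous P by exact: continuous_rsubmx.
have Qc : continuous Q by move=> w; exact: cvg_id.
exact: (@smooth_on_comp_linear R _ _ _ _ P Q f U oU Pc Qc sf).
Qed.

Lemma derive_rsubmxE z u : 'D_u (rsubmx : 'rV[R]_(k + m) -> 'rV[R]_m) z = rsubmx u.
Proof.
rewrite (deriveE _ (differentiable_rsubmx z)) diff_lin //.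
exact: continuous_rsubmx.
Qed.

Lemma derive_rsubmx {W : normedModType R} (f : 'rV[R]_m -> W) z u :
  differentiable f (rsubmx z) ->
  'D_u (fun y : 'rV[R]_(k + m) => f (rsubmx y)) z = 'D_(rsubmx u) f (rsubmx z).
Proof.
by move=> df; rewrite (derive_compose u (differentiable_rsubmx z) df) derive_rsubmxE.
Qed.

Lemma mulmx_col01 p (w : 'M[R]_(p, k + m)) : w *m col_mx 0 1%:M = rsubmx w.
Proof. by rewrite -{1}[w]hsubmxK mul_row_col mulmx0 mulmx1 add0r. Qed.

Lemma jacobian_rsubmx z : jacobian (rsubmx : 'rV[R]_(k + m) -> 'rV[R]_m) z =
  col_mx 0 1%:M.
Proof.
apply/row_matrixP => i; rewrite !rowE mulmx_col01.
by rewrite -(deriveEjacobian _ (differentiable_rsubmx z)) derive_rsubmxE.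
Qed.

End BlockCalculus.

(** * Block matrix algebra of the lifted connection *)

Section LiftAlgebra.
Context {R : realType} {m : nat}.
Implicit Types (g J w D Dg : 'M[R]_m) (t dt : 'cV[R]_m) (u v : 'rV[R]_m) (c : R).

Lemma mul_mx11 {p} (a : 'M[R]_1) (M : 'M[R]_(1, p)) : a *m M = a 0 0 *: M.
Proof. by rewrite {1}[a]mx11_scalar mul_scalar_mx. Qed.

(** The matrix of eta (x) eta + pi_2^* g in the coordinates (t, x), where eta has the components (1,
    tau). *)
Definition lift_gram t g : 'M[R]_(1 + m) := block_mx 1%:M t^T t (t *m t^T + g).

(* In the frame [xi, e_1^L, ..., e_m^L] the connection of the lifted metric in
   the direction [u], with [c = eta(u)], [w = g J^T] and [D] the connection of
   [g] in the direction of the projection of [u]. *)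
Definition frame_conn (c : R) J w D u : 'M[R]_(1 + m) :=
  block_mx 0 (- (u *m J)) (w *m u^T) (D - c *: J).

(** The rows are the coordinates of xi and of the lifts e_a^L = e_a - tau_a xi. *)
Definition frame t : 'M[R]_(1 + m) := block_mx 1%:M 0 (- t) 1%:M.

(* The same connection in the coordinates [(t, x)], with [dt] the derivative of
   [tau] along the projection of [u]. *)
Definition lift_conn c t dt J w D u : 'M[R]_(1 + m) :=
  block_mx (u *m J *m t) (- (u *m J))
    (t *m (u *m J *m t) + w *m u^T - (D - c *: J) *m t + dt)
    (D - c *: J - t *m (u *m J)).

(** The gauge relation between the two forms of the connection: [block_mx 0 0 (- dt) 0] is the
    derivative of [frame]. *)
Lemma frame_lift_conn c t dt J w D u :
  frame t *m lift_conn c t dt J w D u + block_mx 0 0 (- dt) 0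
  = frame_conn c J w D u *m frame t.
Proof.
rewrite /frame /lift_conn /frame_conn !mulmx_block add_block_mx.
rewrite !mul0mx !mulmx0 !mul1mx !mulmx1 !addr0 !add0r !mulNmx !mulmxN opprK.
congr block_mx; rewrite ?mulNmx ?mulmxA //; mx_linear.
Qed.

(** Torsion-freeness for the tangent vectors (a, u) and (b, v). The second hypothesis is d tau =
    omega, split evenly between the two sides by the skew-symmetry of omega. *)
Lemma lift_conn_sym (a b : 'M[R]_1) u v t J w Du Dv dtu dtv :
  v *m Du = u *m Dv ->
  v *m dtu + v *m w *m u^T = u *m dtv + u *m w *m v^T ->
  row_mx b v *m lift_conn ((a + u *m t) 0 0) t dtu J w Du u
  = row_mx a u *m lift_conn ((b + v *m t) 0 0) t dtv J w Dv v.
Proof.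
move=> DE tE; rewrite /lift_conn !mul_row_block !(mulmxDr, mulmxN, mulmxDl, mulNmx).
rewrite !mulmxA !mul_mx11 -!(scalemxAl, scalemxAr) ?mulmxA.
rewrite DE !addmxE.
congr row_mx; last by mx_linear.
have {}tE : v *m dtu = u *m dtv + u *m w *m v^T - v *m w *m u^T by rewrite -tE addrK.
by rewrite tE; mx_linear.
Qed.

Lemma lift_gram_sym t g : g^T = g -> (lift_gram t g)^T = lift_gram t g.
Proof.
move=> sg; rewrite /lift_gram tr_block_mx trmx1 trmxK; congr block_mx.
by rewrite linearD /= trmx_mul trmxK sg.
Qed.

Lemma lift_conn_metric c t dt g J w D u :
  J *m g = - w -> g *m J^T = w -> g^T = g ->
  lift_conn c t dt J w D u *m lift_gram t g
  + lift_gram t g *m (lift_conn c t dt J w D u)^T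
  = block_mx 0 dt^T dt (dt *m t^T + t *m dt^T + (D *m g + g *m D^T)).
Proof.
move=> Jg gJ sg.
(* The second summand is the transpose of this product; since [w] is skew, its contributions cancel
   in the sum and only the derivatives of [t] and of [g] remain. *)
have E : lift_conn c t dt J w D u *m lift_gram t g =
    block_mx 0 (u *m w) (w *m u^T + dt)
      (w *m u^T *m t^T + t *m u *m w + D *m g + c *: w + dt *m t^T).
  rewrite /lift_conn /lift_gram mulmx_block !mulmx1 !mulmxDr !mulmxDl !mulNmx !mulmxA.
  rewrite -[u *m J *m g]mulmxA -[t *m u *m J *m g]mulmxA -!scalemxAl Jg.
  by congr block_mx; rewrite ?mulmxN ?opprK ?mulmxBl -?scalemxAl; mx_linear.
have wT : w^T = - w by rewrite -{1}gJ trmx_mul trmxK sg Jg.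
have -> : lift_gram t g *m (lift_conn c t dt J w D u)^T =
    (lift_conn c t dt J w D u *m lift_gram t g)^T.
  by rewrite [RHS]trmx_mul lift_gram_sym.
rewrite E tr_block_mx add_block_mx !trmx0 addr0 !linearD /= linearZ /=
  !trmx_mul !trmxK wT.
rewrite sg; congr block_mx; rewrite ?mulNmx ?mulmxN ?mulmxA; mx_linear.
Qed.

Lemma lift_gram_unit t g : g \in unitmx -> lift_gram t g \in unitmx.
Proof.
move=> ug; have -> : lift_gram t g = block_mx 1%:M 0 t 1%:M *m block_mx 1%:M t^T 0 g.
  by rewrite mulmx_block !mulmx1 !mul1mx !mulmx0 !mul0mx !addr0.
by rewrite unitmx_mul !unitmxE det_lblock det_ublock !det1 !mul1r unitr1 -unitmxE.
Qed.

(** [F] is the curvature of [frame_conn]: [cu], [cv] are eta(u), eta(v), while [du] is the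
    derivative of eta(v) along u and [dv] that of eta(u) along v. The lower blocks describe the
    curvature on horizontal lifts, where the values of phi lie. *)
Lemma frame_curv (cu cv du dv : R) g J w (Du Dv DuJ DvJ DuDv DvDu : 'M[R]_m)
    (Duw Dvw : 'M[R]_m) u v :
  J *m J = - 1%:M -> J *m w = g -> Du *m J = DuJ + J *m Du -> Dv *m J =
    DvJ + J *m Dv ->
  Duw = Du *m w + w *m Du^T -> Dvw = Dv *m w + w *m Dv^T -> v *m Du = u *m Dv ->
  let F := block_mx 0 (- (v *m DuJ)) (Duw *m v^T) (DuDv - (du *: J + cv *: DuJ))
    - block_mx 0 (- (u *m DvJ)) (Dvw *m u^T) (DvDu - (dv *: J + cu *: DvJ))
    + frame_conn cv J w Dv v *m frame_conn cu J w Du u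
    - frame_conn cu J w Du u *m frame_conn cv J w Dv v in
  dlsubmx F = cu *: (g *m v^T) - cv *: (g *m u^T) /\
  drsubmx F = DuDv - DvDu + Dv *m Du - Du *m Dv - (du - dv) *: J
    - w *m v^T *m (u *m J) + w *m u^T *m (v *m J).
Proof.
move=> JJ Jw DuJE DvJE -> -> DE F.
rewrite /F /frame_conn !mulmx_block !opp_block_mx !add_block_mx block_mxKdl
  block_mxKdr.
have DET : Du^T *m v^T = Dv^T *m u^T by rewrite -!trmx_mul DE.
split.
  rewrite !(mulmxDl, mulNmx, mulmx0) -!scalemxAl !mulmxA.
  rewrite -[w *m Du^T *m _]mulmxA DET Jw mulmxA; mx_linear.
rewrite !(mulmxDl, mulNmx, mulmxDr, mulmxN) -!scalemxAl -!scalemxAr JJ DuJE DvJE.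
mx_linear.
Qed.

Lemma bil_suml (T : 'M[R]_m) u v :
  \sum_k bil T (delta_mx 0 k) v * u 0 k = bil T u v.
Proof.
rewrite /bil -mulmxA mxE; apply: eq_bigr => k _.
by rewrite -mulmxA -rowE [in LHS]mxE mulrC.
Qed.

Lemma bil_sumr (T : 'M[R]_m) u v :
  \sum_k bil T v (delta_mx 0 k) * u 0 k = bil T v u.
Proof. by under eq_bigr do rewrite -bil_tr; rewrite bil_suml bil_tr. Qed.

Lemma sum_row_mx (a : 'rV[R]_(1 + m) -> 'M[R]_1) (b : 'rV[R]_(1 + m) -> 'rV[R]_m) :
  \sum_k (row_mx (a (delta_mx 0 k)) (b (delta_mx 0 k))) 0 k
  = a (row_mx 1%:M 0) 0 0 + \sum_k b (row_mx 0 (delta_mx 0 k)) 0 k.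
Proof.
rewrite big_split_ord big_ord1 /= row_mxEl delta_mx_lshift; congr (_ + _).
  by congr (a (row_mx _ _) 0 0); apply/matrixP => i j; rewrite !mxE !ord1.
by apply: eq_bigr => k _; rewrite row_mxEr delta_mx_rshift.
Qed.

End LiftAlgebra.

Lemma mx11_tr {R : realType} (a : 'M[R]_1) : a^T = a.
Proof. by apply/matrixP => i j; rewrite mxE !ord1. Qed.

(** * Connection, curvature and Ricci tensor of the lifted metric in one chart *)

Section LiftChart.
Context {R : realType} {m : nat} (U : set 'rV[R]_m) (g J : 'rV[R]_m -> 'M[R]_m)
  (tau : 'rV[R]_m -> 'cV[R]_m).
Local Notation omega := (fun y => g y *m (J y)^T).
Context (oU : open U) (smoothg : smooth_on U g)
  (symg : forall y, U y -> (g y)^T = g y)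
  (unitg : forall y, U y -> g y \in unitmx)
  (smoothJ : smooth_on U J)
  (J2 : forall y, U y -> J y *m J y = - 1%:M)
  (hermg : forall y, U y -> J y *m g y *m (J y)^T = g y)
  (parJ : forall a y, U y -> J y *m conn g a y + 'D_a J y = conn g a y *m J y)
  (smootht : smooth_on U tau)
  (dtau : forall u v y, U y ->
    v *m 'D_u tau y - u *m 'D_v tau y = 2 *: (u *m omega y *m v^T)).
Implicit Types (u v : 'rV[R]_(1 + m)).
Local Notation Gbar := (fun z : 'rV[R]_(1 + m) =>
  lift_gram (tau (rsubmx z)) (g (rsubmx z))).
Local Notation Ubar := (rsubmx @^-1` U : set 'rV[R]_(1 + m)).

Let oUbar : open Ubar. Proof. exact: open_rsubmx. Qed.

Let Jg y : U y -> J y *m g y = - omega y.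
Proof.
move=> Uy /=; rewrite -[in RHS](hermg Uy) -!mulmxA -trmx_mul J2 //.
by rewrite linearN /= trmx1 !mulmxN mulmx1 opprK.
Qed.

Let omega_mx_skew (u v : 'rV[R]_m) y : U y ->
  v *m omega y *m u^T = - (u *m omega y *m v^T).
Proof.
move=> Uy; rewrite -[LHS]trmxK [in LHS](mx11_tr (_ *m _)).
by rewrite !trmx_mul !trmxK symg // Jg // mulNmx mulmxN mulmxA.
Qed.

(** The value of eta on a constant vector. It does not involve the coordinate t, so it is a function
    on [U] and its derivatives on the cylinder reduce to derivatives on [U]. *)
Let eta_at u (y : 'rV[R]_m) : R := (lsubmx u + rsubmx u *m tau y) 0 0.

Let smooth_on_eta u : smooth_on U (eta_at u).
Proof.
apply: (smooth_on_mxP _ oU).1; apply: smooth_on_add => //; first exact: smooth_on_cst.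
by apply: smooth_on_mulmx => //; exact: smooth_on_cst.
Qed.

Let derive_eta u a y : U y -> 'D_a (eta_at u) y = (rsubmx u *m 'D_a tau y) 0 0.
Proof.
move=> Uy; have dt := smooth_on_diff smootht Uy.
have d1 : differentiable (fun y => rsubmx u *m tau y) y.
  exact: differentiable_mulmx (differentiable_cst _ y) dt.
have d2 : differentiable (fun y => lsubmx u + rsubmx u *m tau y) y.
  exact: differentiableD (differentiable_cst _ y) d1.
apply: etrans (derive_entry a 0 0 d2) _.
rewrite (derive_addmx a (differentiable_cst _ y) d1) derive_cst add0r.
by rewrite (derive_mulmxl _ a dt).
Qed.

Let smooth_gram : smooth_on U (fun y => lift_gram (tau y) (g y)).
Proof.
apply: smooth_on_block_mx => //; first exact: smooth_on_cst.
  exact: smooth_on_trmx.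
apply: smooth_on_add => //; apply: smooth_on_mulmx => //; exact: smooth_on_trmx.
Qed.

Let smooth_Gbar : smooth_on Ubar Gbar.
Proof.
exact: (@smooth_on_rsubmx _ _ _ _ U (fun y => lift_gram (tau y) (g y)) oU
  smooth_gram).
Qed.

Let unit_Gbar z : Ubar z -> Gbar z \in unitmx.
Proof. by move=> Uz; apply: lift_gram_unit; exact: unitg. Qed.

Let derive_gram a y : U y -> 'D_a (fun y => lift_gram (tau y) (g y)) y =
  block_mx 0 ('D_a tau y)^T ('D_a tau y)
    ('D_a tau y *m (tau y)^T + tau y *m ('D_a tau y)^T + 'D_a g y).
Proof.
move=> Uy; have dt := smooth_on_diff smootht Uy; have dg := smooth_on_diff smoothg Uy.
have dtT := differentiable_trmx dt; have dtt := differentiable_mulmx dt dtT.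
have [_ ->] := derive_block_mx a (differentiable_cst (1%:M : 'M[R]_1) y) dtT dt
  (differentiableD dtt dg).
rewrite derive_cst (derive_trmx a dt); congr block_mx.
apply: etrans (derive_addmx a dtt dg) _.
by rewrite (derive_mulmx a dt dtT) (derive_trmx a dt).
Qed.

Let bar_conn u (z : 'rV[R]_(1 + m)) : 'M[R]_(1 + m) := let y := rsubmx z in
  lift_conn (eta_at u y) (tau y) ('D_(rsubmx u) tau y) (J y) (omega y)
    (conn g (rsubmx u) y) (rsubmx u).

Lemma conn_lift z u : Ubar z -> conn Gbar u z = bar_conn u z.
Proof.
move=> Uz; set y := rsubmx z; have Uy : U y by [].
have dt := smooth_on_diff smootht Uy.
apply: (@conn_unique _ _ Gbar z (bar_conn^~ z)).
- move=> a p q; rewrite /bar_conn -/y /lift_conn scale_block_mx add_block_mx.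
  have -> : eta_at (a *: p + q) y = a * eta_at p y + eta_at q y.
    by rewrite /eta_at !linearP /= mulmxDl -scalemxAl !addmxE !scalemxE; ring.
  rewrite linearP /= (derive_dir_linear dt) conn_linear.
  move: ('D_(rsubmx p) tau y) ('D_(rsubmx q) tau y) (conn _ _ _) (conn _ _ _) =>
    D1 D2 C1 C2.
  move: (eta_at p y) (eta_at q y) => e1 e2.
  by rewrite linearP /=; congr block_mx;
    rewrite !(mulmxDl, mulmxDr, mulmxN, mulNmx) -?scalemxAl -?scalemxAr -?scalemxAl;
    mx_linear.
- exact: smooth_on_diff smooth_Gbar Uz.
- by apply: lift_gram_sym; exact: symg.
- exact: unit_Gbar.
- move=> p q; rewrite /bar_conn /eta_at -/y.
  have E (a : 'rV[R]_(1 + m)) (M : 'M[R]_(1 + m)) :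
    a *m M = row_mx (lsubmx a) (rsubmx a) *m M by rewrite hsubmxK.
  rewrite E [RHS]E.
  apply: lift_conn_sym; first exact: conn_symU oU smoothg symg _ _ _ Uy.
  have -> : rsubmx q *m omega y *m (rsubmx p)^T =
    - (rsubmx p *m omega y *m (rsubmx q)^T).
    exact: omega_mx_skew.
  have := dtau (rsubmx p) (rsubmx q) Uy; rewrite scaler_nat mulr2n => D.
  by apply/eqP; rewrite subr_eq -addrA -D addrC subrK.
- move=> p.
  have -> : 'D_p Gbar z = 'D_(rsubmx p) (fun y => lift_gram (tau y) (g y)) y.
    exact: (@derive_rsubmx R 1 m _ (fun y => lift_gram (tau y) (g y)) z p
      (smooth_on_diff smooth_gram Uy)).
  rewrite (derive_gram _ Uy) (conn_metric _ oU Uy (smooth_on_diff smoothg Uy) symg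
    (unitg Uy)).
  by rewrite /bar_conn lift_conn_metric // ?Jg ?symg.
Qed.

Let frame_conn_at u (y : 'rV[R]_m) :=
  frame_conn (eta_at u y) (J y) (omega y) (conn g (rsubmx u) y) (rsubmx u).

Let smooth_w : smooth_on U omega. Proof. exact: smooth_on_omega. Qed.

Let derive_frame_conn a u y : U y -> differentiable (frame_conn_at u) y /\
  'D_a (frame_conn_at u) y =
  block_mx 0 (- (rsubmx u *m 'D_a J y)) ('D_a omega y *m (rsubmx u)^T)
    ('D_a (conn g (rsubmx u)) y
     - ((rsubmx u *m 'D_a tau y) 0 0 *: J y + eta_at u y *: 'D_a J y)).
Proof.
move=> Uy.
have dJ := smooth_on_diff smoothJ Uy; have dw := smooth_on_diff smooth_w Uy.
have dC := smooth_on_diff (smooth_on_conn (rsubmx u) oU smoothg unitg) Uy.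
have de := smooth_on_diff (smooth_on_eta u) Uy.
have d1 : differentiable (fun y => rsubmx u *m J y) y.
  exact: differentiable_mulmx (differentiable_cst _ y) dJ.
have d2 : differentiable (fun y => - (rsubmx u *m J y)) y.
  exact: differentiableN d1.
have d3 : differentiable (fun y => omega y *m (rsubmx u)^T) y.
  exact: differentiable_mulmx dw (differentiable_cst _ y).
have d4 : differentiable (fun y => eta_at u y *: J y) y.
  exact: differentiable_scalemx.
have d5 : differentiable (fun y => - (eta_at u y *: J y)) y
  by exact: differentiableN d4.
have d6 : differentiable (fun y => conn g (rsubmx u) y - eta_at u y *: J y) y.
  exact: differentiableD dC d5.
have [d ->] := derive_block_mx a (differentiable_cst (0 : 'M[R]_1) y) d2 d3 d6.
split=> //; rewrite derive_cst (derive_oppmx a d1) (derive_mulmxl _ a dJ).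
rewrite (derive_mulmxr _ a dw) (derive_addmx a dC d5) (derive_oppmx a d4).
by rewrite (derive_scalemx a de dJ) (derive_eta _ _ Uy).
Qed.

Let conn_bar u (z : 'rV[R]_(1 + m)) : 'M[R]_(1 + m) := frame_conn_at u (rsubmx z).

(** Only the vectors acted on are expressed in the frame; [u] remains a constant coordinate vector,
    so [curv] applies to [conn_bar] unchanged. *)
Let conn_bar_gauge u z : Ubar z ->
  frame (tau (rsubmx z)) *m conn Gbar u z
    + 'D_u (fun z : 'rV[R]_(1 + m) => frame (tau (rsubmx z))) z
  = conn_bar u z *m frame (tau (rsubmx z)).
Proof.
move=> Uz; have dt := smooth_on_diff smootht Uz.
have dNt : differentiable (fun y => - tau y) (rsubmx z) by exact: differentiableN dt.
have [df Df] := derive_block_mx (rsubmx u)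
  (differentiable_cst (1%:M : 'M[R]_1) (rsubmx z))
  (differentiable_cst (0 : 'M[R]_(1, m)) (rsubmx z)) dNt
  (differentiable_cst (1%:M : 'M[R]_m) (rsubmx z)).
rewrite (conn_lift _ Uz) /conn_bar /frame_conn_at.
rewrite -(frame_lift_conn _ _ ('D_(rsubmx u) tau (rsubmx z))); congr (_ + _).
apply: etrans (derive_rsubmx u df) _; rewrite Df !derive_cst.
by rewrite (derive_oppmx _ dt).
Qed.

Let curv_bar u v z : Ubar z ->
  frame (tau (rsubmx z)) *m curv (conn Gbar) u v z
  = curv conn_bar u v z *m frame (tau (rsubmx z)).
Proof.
move=> Uz.
have sf : smooth_on Ubar (fun z : 'rV[R]_(1 + m) => frame (tau (rsubmx z))).
  apply: (@smooth_on_rsubmx _ _ _ _ U (fun y => frame (tau y)) oU).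
  apply: smooth_on_block_mx => //; try exact: smooth_on_cst.
  apply: (@smooth_on_eq _ _ _ (fun x => (-1) *: tau x)) => //.
    by move=> x _; rewrite scaleN1r.
  by apply: smooth_on_scale => //; exact: smooth_on_cst.
have dG a : differentiable (conn Gbar a) z.
  exact: smooth_on_diff (smooth_on_conn a oUbar smooth_Gbar unit_Gbar) Uz.
have dA a : differentiable (conn_bar a) z.
  apply: (@differentiable_comp _ _ _ _ rsubmx (frame_conn_at a)).
    exact: differentiable_rsubmx.
  by have [] := derive_frame_conn 0 a Uz.
exact: (@gauge_curv _ _ _ _ Ubar (fun z : 'rV[R]_(1 + m) => frame (tau (rsubmx z)))
  (conn Gbar) conn_bar u v z oUbar Uz sf dG dA conn_bar_gauge).
Qed.

Let curv_bar_lower u v z (y := rsubmx z) (p := rsubmx u) (q := rsubmx v) : Ubar z ->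
  dlsubmx (curv conn_bar u v z)
    = eta_at u y *: (g y *m q^T) - eta_at v y *: (g y *m p^T) /\
  drsubmx (curv conn_bar u v z)
    = curv (conn g) p q y - (2 * bil (omega y) p q) *: J y
      - omega y *m q^T *m (p *m J y) + omega y *m p^T *m (q *m J y).
Proof.
move=> Uz; have Uy : U y by [].
have D a b : 'D_a (conn_bar b) z = 'D_(rsubmx a) (frame_conn_at b) y.
  by apply: derive_rsubmx; have [] := derive_frame_conn 0 b Uy.
have DA a b : 'D_a (conn_bar b) z = _ :=
  etrans (D a b) (derive_frame_conn (rsubmx a) b Uy).2.
have E : curv conn_bar u v z = _ :=
  congr2
    (fun a b => a - b + conn_bar v z *m conn_bar u z - conn_bar u z *m conn_bar v z)
    (DA u v) (DA v u).
have Jw : J y *m omega y = g y by rewrite mulmxA hermg.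
have parD a : conn g a y *m J y = 'D_a J y + J y *m conn g a y
  by rewrite -parJ // addrC.
have dw a : 'D_a omega y = conn g a y *m omega y + omega y *m (conn g a y)^T.
  exact: derive_omega oU smoothg symg unitg smoothJ parJ _ _ Uy.
have [E1 E2] := frame_curv (eta_at u y) (eta_at v y) ((q *m 'D_p tau y) 0 0)
  ((p *m 'D_q tau y) 0 0) ('D_p (conn g q) y) ('D_q (conn g p) y)
  (J2 Uy) Jw (parD p) (parD q) (dw p) (dw q) (conn_symU oU smoothg symg p q Uy).
rewrite E; split; first exact: E1.
(* The derivatives of eta(v) along u and of eta(u) along v differ by 2 d tau, which is how 2 omega
   comes to multiply J. *)
have <- : (q *m 'D_p tau y) 0 0 - (p *m 'D_q tau y) 0 0 = 2 * bil (omega y) p q.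
  by rewrite -oppmxE -addmxE dtau // scalemxE.
exact: E2.
Qed.

(** The second argument is the lift v^L. The trace runs over the coordinate vectors (1, 0) and (0,
    e_k); the frame is used for the curvature endomorphism applied to v^L. *)
Lemma ricci_lift z u (v : 'rV[R]_m) : Ubar z ->
  bil (ricci Gbar z) u (row_mx 0 v *m frame (tau (rsubmx z))) =
  bil (ricci g (rsubmx z)) (rsubmx u) v - 2 * bil (g (rsubmx z)) (rsubmx u) v.
Proof.
move=> Uz; set y := rsubmx z; have Uy : U y by []; set p := rsubmx u.
rewrite (bil_ricci _ _ oUbar smooth_Gbar unit_Gbar Uz).
have E w : row_mx 0 v *m frame (tau y) *m curv (conn Gbar) w u z =
  row_mx
    (v *m dlsubmx (curv conn_bar w u z) - v *m drsubmx (curv conn_bar w u z) *m tau y)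
    (v *m drsubmx (curv conn_bar w u z)).
  rewrite -mulmxA curv_bar // mulmxA -[curv conn_bar w u z in LHS]submxK.
  rewrite mul_row_block !mul0mx !add0r /frame mul_row_block !mulmx1 !mulmx0 add0r.
  by rewrite mulmxN.
have -> : \sum_k
    (row_mx 0 v *m frame (tau y) *m curv (conn Gbar) (delta_mx 0 k) u z) 0 k
  = \sum_k (row_mx (v *m dlsubmx (curv conn_bar (delta_mx 0 k) u z)
        - v *m drsubmx (curv conn_bar (delta_mx 0 k) u z) *m tau y)
      (v *m drsubmx (curv conn_bar (delta_mx 0 k) u z))) 0 k.
  by apply: eq_bigr => k _; rewrite E.
rewrite (sum_row_mx (fun w => v *m dlsubmx (curv conn_bar w u z)
  - v *m drsubmx (curv conn_bar w u z) *m tau y)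
  (fun w => v *m drsubmx (curv conn_bar w u z))).
have dC := differentiable_conn oU smoothg unitg Uy.
have curv0 : curv (conn g) 0 p y = 0.
  have := curv_linearl p (conn_linear g) dC 1 0 0.
  by rewrite scaler0 addr0 scale1r -[LHS]addr0 => /addrI <-.
(* For the direction xi the projection is 0 and eta is 1: only the term eta(xi) g(v, p) survives. *)
have vertical : (v *m dlsubmx (curv conn_bar (row_mx 1%:M 0) u z)
    - v *m drsubmx (curv conn_bar (row_mx 1%:M 0) u z) *m tau y) 0 0 = bil (g y) v p.
  have [-> ->] := curv_bar_lower (row_mx 1%:M 0) u Uz.
  rewrite -/y -/p row_mxKr curv0 /eta_at row_mxKl row_mxKr mul0mx addr0.
  rewrite /bil !mul0mx trmx0 !mulmx0 zeromxE mulr0 scale0r scaler0 !subr0.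
  by rewrite [1%:M 0 0]mxE eqxx mulr1n scale1r !(mulmx0, mul0mx, addr0, subr0) mulmxA.
have horizontal k : (v *m drsubmx (curv conn_bar (row_mx 0 (delta_mx 0 k)) u z)) 0 k =
    (v *m curv (conn g) (delta_mx 0 k) p y) 0 k
    - 2 * (bil (omega y) (delta_mx 0 k) p * (v *m J y) 0 k)
    - bil (omega y) v p * ((delta_mx 0 k : 'rV[R]_m) *m J y) 0 k
    + bil (omega y) v (delta_mx 0 k) * (p *m J y) 0 k.
  have [_ ->] := curv_bar_lower (row_mx 0 (delta_mx 0 k)) u Uz.
  rewrite -/y -/p row_mxKr !mulmxDr !mulmxN -scalemxAr.
  rewrite !mulmxA !mul_mx11 -!scalemxAl.
  by rewrite !addmxE !oppmxE !scalemxE mulrA /bil !mulmxA.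
have trJ : \tr (J y) = 0.
  have : \tr (J y) = - \tr (J y).
    rewrite -{1}[J y](mulmxK (unitg Uy)) Jg // mulNmx linearN /=; congr (- _).
    by rewrite mxtrace_mulC mulmxA mulVmx ?unitg // mul1mx mxtrace_tr.
  move: (\tr _) => t; lra.
(* Beside Ric(p, v), the horizontal terms sum to - 2 omega(v J, p) - omega(v, p) tr J + omega(v, p
   J) = - 2 g(v, p) - 0 - g(v, p); the vertical + g(v, p) leaves - 2 g(v, p). *)
apply: etrans (congr2 +%R vertical (eq_bigr _ (fun k _ => horizontal k))) _.
rewrite (bil_ricci _ _ oU smoothg unitg Uy).
rewrite !(big_split, sumrN) /= -!mulr_sumr row_trace trJ mulr0 bil_suml bil_sumr.
rewrite !bil_mulr (bil_JJ hermg Uy).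
have -> : p *m J y *m J y = - p by rewrite -mulmxA J2 // mulmxN mulmx1.
rewrite bilNr (bil_sym p v (symg Uy)).
by ring.
Qed.

End LiftChart.

(** * Kaehler manifolds and their lifts *)

Lemma bil_congruence {R : realType} {p q} (P : 'M[R]_(p, q)) (T : 'M[R]_q) u v :
  bil (P *m T *m P^T) u v = bil T (u *m P) (v *m P).
Proof. by rewrite /bil trmx_mul !mulmxA. Qed.

Lemma sum3_linear {R : realType} (c a1 a2 a3 b1 b2 b3 : R) :
  a1 + a2 + a3 = 0 -> b1 + b2 + b3 = 0 ->
  a1 + c * b1 + (a2 + c * b2) + (a3 + c * b3) = 0.
Proof.
move=> Ea Eb; have -> : a1 + c * b1 + (a2 + c * b2) + (a3 + c * b3)
  = a1 + a2 + a3 + c * (b1 + b2 + b3) by ring.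
by rewrite Ea Eb mulr0 addr0.
Qed.

Section Assembly.
Context {R : realType} {m : nat}.

(** For a skew form the derivatives of the fields cancel against the brackets. Closedness thus
    becomes a cyclic identity between derivatives of the components, on vectors at a point. *)
Lemma ext_d2_skew (B : 'rV[R]_m -> 'M[R]_m) (X Y Z : 'rV[R]_m -> 'rV[R]_m) x :
  differentiable B x -> differentiable X x -> differentiable Y x ->
    differentiable Z x ->
  (forall u v, bil (B x) u v = - bil (B x) v u) ->
  ext_d2 B X Y Z x = 3^-1 * (bil ('D_(X x) B x) (Y x) (Z x)
    + bil ('D_(Y x) B x) (Z x) (X x) + bil ('D_(Z x) B x) (X x) (Y x)).
Proof.
move=> dB dX dY dZ sB; rewrite /ext_d2 /lie_bracket.
rewrite (derive_bil (X x) dB dY dZ) (derive_bil (Y x) dB dZ dX)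
  (derive_bil (Z x) dB dX dY).
move: ('D_(X x) B x) ('D_(Y x) B x) ('D_(Z x) B x) => BX BY BZ.
move: ('D_(X x) Y x) ('D_(X x) Z x) ('D_(Y x) X x) ('D_(Y x) Z x) ('D_(Z x) X x)
  ('D_(Z x) Y x).
move=> XY XZ YX YZ ZX ZY; rewrite !bilAl !bilNl.
rewrite (sB (Y x) XZ) (sB (Z x) YX) (sB (X x) ZY).
by congr (_ * _); ring.
Qed.

(** A nonzero vector of the kernel would have length 0. *)
Lemma posdef_unit (A : 'M[R]_m) : (forall u, u != 0 -> 0 < bil A u u) -> A \in unitmx.
Proof.
move=> pA; rewrite -row_free_unit -kermx_eq0 -nz_row_eq0; apply/eqP/eqP.
apply: contraT => u0; have := pA _ u0.
by rewrite /bil (sub_kermxP (nz_row_sub _)) mul0mx mxE ltxx.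
Qed.

Section Chart.
Context {N : manifold R m} (J g : matrix_field N) (tau : covector_field N).
Context (kJg : kaehler J g) (i : atlas N).
Local Notation U := (cod i).

Let oU : open U. Proof. exact: cod_open. Qed.

Lemma chart_smooth_metric : smooth_on U (g i).
Proof. by have [[[+ _] _ _] _ _ _ _] := kJg; exact. Qed.

Lemma chart_sym y : U y -> (g i y)^T = g i y.
Proof.
move=> Uy; have [[_ sg _] _ _ _ _] := kJg.
by apply: bil_inj => u v; rewrite bil_tr sg.
Qed.

Lemma chart_unit y : U y -> g i y \in unitmx.
Proof.
by move=> Uy; have [[_ _ pg] _ _ _ _] := kJg; apply: posdef_unit; exact: pg.
Qed.

Lemma chart_smooth_J : smooth_on U (J i).
Proof. by have [_ [+ _] _ _ _] := kJg; exact. Qed.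

Lemma chart_J2 y : U y -> J i y *m J i y = - 1%:M.
Proof. by have [_ _ + _ _] := kJg; exact. Qed.

Lemma chart_herm y : U y -> J i y *m g i y *m (J i y)^T = g i y.
Proof.
move=> Uy; have [_ _ _ hg _] := kJg.
by apply: bil_inj => u v; rewrite bil_mulr bil_mull hg.
Qed.

(** The condition nabla J = 0, tested on constant fields, is the gauge relation with K = J. *)
Lemma chart_parallel a y : U y ->
  J i y *m conn (g i) a y + 'D_a (J i) y = conn (g i) a y *m J i y.
Proof.
move=> Uy; have [_ _ _ _ pJ] := kJg.
have dJ := smooth_on_diff chart_smooth_J Uy; have dg := smooth_on_diff
  chart_smooth_metric Uy.
apply/row_matrixP => b; rewrite !rowE; set w := delta_mx 0 b.
have := pJ i (cst a) (cst w) (smooth_on_cst a) (smooth_on_cst w) y Uy.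
rewrite /nabla /= derive_cst add0r !christoffel_conn // => E.
rewrite mulmxDr !mulmxA -E addrC; congr (_ + _).
by rewrite -(derive_mulmxl w a dJ).
Qed.

Context (ftau : form1 tau) (dtau : is_exterior_derivative tau (twist g J)).

Lemma chart_smooth_tau : smooth_on U (tau i).
Proof. by have [+ _] := ftau; exact. Qed.

(** Constant fields have zero bracket, and the factor 2 clears the 1/2 in [ext_d1]. *)
Lemma chart_dtau u v y : U y ->
  v *m 'D_u (tau i) y - u *m 'D_v (tau i) y = 2 *: (u *m (g i y *m (J i y)^T) *m v^T).
Proof.
move=> Uy; have dt := smooth_on_diff chart_smooth_tau Uy.
have D a b : 'D_a (fun y => pairing b (tau i y)) y = (b *m 'D_a (tau i) y) 0 0.
  apply: etrans (derive_entry a 0 0 (differentiable_mulmx (differentiable_cst b y)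
    dt)) _.
  by rewrite (derive_mulmxl b a dt).
have := dtau (smooth_on_cst u) (smooth_on_cst v) Uy.
rewrite /ext_d1 /lie_bracket !derive_cst subrr /pairing mul0mx zeromxE subr0.
rewrite [X in _ * (X - _)]D [X in _ * (_ - X)]D => E.
apply/matrixP => k l; rewrite !ord1 addmxE oppmxE scalemxE.
have -> : (u *m (g i y *m (J i y)^T) *m v^T) 0 0 = bil (twist g J i y) u v by [].
by rewrite E mulVKf // pnatr_eq0.
Qed.

Lemma lift_metricE z : lift_metric tau g i z =
  lift_gram (tau i (rsubmx z)) (g i (rsubmx z)).
Proof.
have etaE : Defs.eta tau i z = col_mx 1%:M (tau i (rsubmx z)).
  rewrite /Defs.eta /pi2_pull1 /pull1 jacobian_rsubmx /dt.
  by rewrite mul_col_mx mul0mx mul1mx add_col_mx addr0 add0r.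
rewrite /lift_metric /pi2_pull2 /pull2 etaE jacobian_rsubmx.
rewrite !tr_col_mx mul_col_row mul_col_mx mul0mx mul1mx mul_col_row.
by rewrite !trmx1 !trmx0 !mul1mx !mulmx1 !mul0mx !mulmx0 add_block_mx !addr0.
Qed.

Lemma hlift_frame z (v : 'rV[R]_m) :
  hlift tau i z v = row_mx 0 v *m frame (tau i (rsubmx z)).
Proof.
rewrite /hlift /frame mul_row_block !mul0mx !add0r mulmxN mulmx1.
rewrite /xi scale_row_mx scaler0 opp_row_mx add_row_mx oppr0 addr0 sub0r.
by rewrite /pairing scalemx1 -mx11_scalar.
Qed.

(** Any vector is eta(w) xi plus the lift of its projection, and phi kills the first part. *)
Lemma mulmx_lift_phi phi z (w : 'rV[R]_(1 + m)) : is_lift_phi tau J phi ->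
  @cod _ _ (cylinder N) i z ->
  w *m phi i z = hlift tau i z (rsubmx w *m J i (rsubmx z)).
Proof.
move=> Hphi iz; have [phi0 phiL] := Hphi i z iz.
have {1}-> : w = (lsubmx w 0 0 + pairing (rsubmx w) (tau i (rsubmx z))) *: xi
              + hlift tau i z (rsubmx w).
  rewrite scalerDl /hlift -addrA [_ *: xi + (_ - _)]addrC subrK.
  rewrite /xi scale_row_mx scaler0.
  by rewrite add_row_mx addr0 add0r scalemx1 -mx11_scalar hsubmxK.
by rewrite mulmxDl phiL -scalemxAl phi0 scaler0 add0r.
Qed.

(* rho - 2 omega *)
Definition reduced_form (y : 'rV[R]_m) : 'M[R]_m :=
  twist (ricci_tensor g) J i y - 2 *: twist g J i y.

Lemma bil_reduced_form y a b : bil (reduced_form y) a b =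
  bil (ricci (g i) y) a (b *m J i y) - 2 * bil (g i y) a (b *m J i y).
Proof.
rewrite /reduced_form /twist bilAm bilNm bil_mulr; congr (_ - _).
by rewrite /bil -scalemxAr -scalemxAl scalemxE trmx_mul !mulmxA.
Qed.

Lemma pull2_rsubmx (T : 'rV[R]_m -> 'M[R]_m) (z : 'rV[R]_(1 + m)) :
  pull2 rsubmx T z = col_mx 0 1%:M *m T (rsubmx z) *m (col_mx 0 1%:M)^T.
Proof. by rewrite /pull2 jacobian_rsubmx. Qed.

(** The second argument of the lifted Ricci tensor is always a lift (J v)^L, which is the case
    covered by [ricci_lift]. *)
Lemma rhobar_chart phi z : is_lift_phi tau J phi -> @cod _ _ (cylinder N) i z ->
  twist (ricci_tensor (lift_metric tau g)) phi i z = pull2 rsubmx reduced_form z.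
Proof.
move=> Hphi iz; apply: bil_inj => u v.
rewrite pull2_rsubmx bil_congruence !mulmx_col01 /twist bil_mulr mulmx_lift_phi //
  hlift_frame.
have -> : ricci_tensor (lift_metric tau g) i z =
    ricci (fun z : 'rV[R]_(1 + m) => lift_gram (tau i (rsubmx z)) (g i (rsubmx z))) z.
  by rewrite /ricci_tensor; congr (ricci _ z); apply/funext => y; exact: lift_metricE.
rewrite (ricci_lift oU chart_smooth_metric chart_sym chart_unit
  chart_smooth_J chart_J2
  chart_herm chart_parallel chart_smooth_tau chart_dtau) //.
by rewrite bil_reduced_form.
Qed.

Lemma smooth_on_reduced_form : smooth_on U reduced_form.
Proof.
have sr := smooth_on_rho oU chart_smooth_metric chart_unit chart_smooth_J.
have so := smooth_on_omega oU chart_smooth_metric chart_smooth_J.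
apply: (@smooth_on_eq _ _ _ (fun y => ricci (g i) y *m (J i y)^T
    + (-2) *: (g i y *m (J i y)^T))) => //.
  by move=> y _; rewrite scaleNr.
by apply: smooth_on_add => //; apply: smooth_on_scale => //; exact: smooth_on_cst.
Qed.

Lemma reduced_form_skew y u v : U y ->
  bil (reduced_form y) u v = - bil (reduced_form y) v u.
Proof.
move=> Uy; rewrite !bil_reduced_form -!bil_mulr.
rewrite (rho_skew oU chart_smooth_metric chart_sym chart_unit chart_smooth_J chart_J2
  chart_herm chart_parallel Uy).
rewrite !bil_mulr (omega_skew chart_sym chart_J2 chart_herm Uy).
by rewrite mulrN opprB opprK addrC.
Qed.

Lemma derive_reduced_form_cyclic y u v w : U y ->
  bil ('D_w reduced_form y) u v + bil ('D_u reduced_form y) v w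
  + bil ('D_v reduced_form y) w u = 0.
Proof.
move=> Uy.
have dr := smooth_on_diff (smooth_on_rho oU chart_smooth_metric chart_unit
  chart_smooth_J) Uy.
have dw := smooth_on_diff (smooth_on_omega oU chart_smooth_metric chart_smooth_J) Uy.
have D a : 'D_a reduced_form y =
    'D_a (fun y => ricci (g i) y *m (J i y)^T) y + (-2) *: 'D_a (fun y =>
      g i y *m (J i y)^T) y.
  have dm := differentiable_scalemx (differentiable_cst (-2 : R) y) dw.
  have -> : reduced_form = (fun y => ricci (g i) y *m (J i y)^T
      + cst (-2) y *: (g i y *m (J i y)^T)).
    by apply/funext => x; rewrite /reduced_form /cst scaleNr.
  rewrite (derive_addmx a dr dm) (derive_scalemx a (differentiable_cst (-2 : R) y)
    dw).
  by rewrite derive_cst scale0r add0r.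
have E a b c : bil ('D_a reduced_form y) b c =
    bil ('D_a (fun y => ricci (g i) y *m (J i y)^T) y) b c
    + (-2) * bil ('D_a (fun y => g i y *m (J i y)^T) y) b c.
  by rewrite D addrC bilDm addrC.
apply: etrans (congr2 +%R (congr2 +%R (E w u v) (E u v w)) (E v w u)) _.
have E1 := derive_rho_cyclic oU chart_smooth_metric chart_sym chart_unit
  chart_smooth_J
  chart_J2 chart_herm chart_parallel u v w Uy.
have E2 := derive_omega_cyclic oU chart_smooth_metric chart_sym chart_unit
  chart_smooth_J
  chart_J2 chart_herm chart_parallel u v w Uy.
exact: sum3_linear E1 E2.
Qed.

End Chart.
End Assembly.

(** * Change of charts on the base and on the cylinder, and the theorem *)

Section Transition.
Context {R : realType} {m : nat} {N : manifold R m}.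
Implicit Types i j : atlas N.

Lemma open_overlap i j : open (overlap i j).
Proof.
rewrite openE => x [ix jx]; apply: filterI.
  by apply: open_nbhs_nbhs; split => //; exact: cod_open.
apply: (param_continuous ix); apply: open_nbhs_nbhs; split => //.
exact: dom_open.
Qed.

Lemma smooth_on_transition i j : smooth_on (overlap i j) (transition i j).
Proof. exact: transition_smooth. Qed.

Lemma transition_cod i j x : overlap i j x -> cod j (transition i j x).
Proof. by move=> [ix jx]; exact: chart_cod. Qed.

Lemma transition_overlap i j x : overlap i j x -> overlap j i (transition i j x).
Proof.
move=> [ix jx]; split; first exact: chart_cod.
by rewrite /transition /= chartK //; exact: param_dom.
Qed.

Lemma transitionK i j x : overlap i j x -> transition j i (transition i j x) = x.
Proof. by move=> [ix jx]; rewrite /transition /= chartK // paramK. Qed.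

(** The inverse is the Jacobian of the opposite transition map, by the chain rule on an open
    overlap. *)
Lemma transition_jacobian_unit i j x : overlap i j x ->
  jacobian (transition i j) x \in unitmx.
Proof.
move=> ijx; have dF := smooth_on_diff (@smooth_on_transition i j) ijx.
have dF' := smooth_on_diff (@smooth_on_transition j i) (transition_overlap ijx).
suff E : jacobian (transition i j) x
    *m jacobian (transition j i) (transition i j x) = 1%:M.
  exact: (mulmx1_unit E).1.
apply/row_matrixP => k; rewrite !rowE mulmx1 mulmxA.
rewrite -(deriveEjacobian _ dF) -(deriveEjacobian _ dF') -(derive_compose _ dF dF').
rewrite (derive_eq_on_open _ (@open_overlap i j) ijx (@transitionK i j)).
exact: derive_id.
Qed.

(** Naturality of Ricci and the transformation law of [g] handle the two bilinear forms; J passes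
    through the Jacobian by its own transformation law. *)
Lemma reduced_form_transition (J g : matrix_field N) i j x : kaehler J g ->
  overlap i j x ->
  reduced_form J g i x = pull2 (transition i j) (reduced_form J g j) x.
Proof.
move=> kJg ijx; have [[[_ gT] _ _] [_ JT] _ _ _] := kJg.
have jFx := transition_cod ijx.
have gE y : overlap i j y -> g i y = jacobian (transition i j) y
    *m g j (transition i j y) *m (jacobian (transition i j) y)^T by exact: gT.
have W U V (f : 'rV[R]_m -> 'M[R]_m) : V `<=` U -> smooth_on U f -> smooth_on V f.
  by move=> VU sf vs y /VU; exact: sf.
have ov : overlap i j `<=` cod i by move=> y [].
have ricE := ricci_natural (@open_overlap i j) (cod_open (i := j))
  (@smooth_on_transition i j) (W _ _ _ ov (chart_smooth_metric kJg (i := i)))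
  (chart_smooth_metric kJg (i := j)) (fun y Uy => chart_sym kJg (ov y Uy))
  (chart_sym kJg (i := j)) (fun y Uy => chart_unit kJg (ov y Uy))
  (chart_unit kJg (i := j)) (@transition_cod i j) (@transition_jacobian_unit i j) gE
    ijx.
have JE := JT i j x ijx.
apply: bil_inj => u v; rewrite /pull2 bil_congruence !bil_reduced_form.
rewrite ricE (gE x ijx) !bil_congruence -!mulmxA JE.
by [].
Qed.

Lemma transition_cylinder i j (z : 'rV[R]_(1 + m)) :
  rsubmx (@transition _ _ (cylinder N) i j z) = transition i j (rsubmx z).
Proof. by rewrite /transition /= row_mxKr. Qed.

Lemma overlap_cylinder i j (z : 'rV[R]_(1 + m)) :
  @overlap _ _ (cylinder N) i j z -> overlap i j (rsubmx z).
Proof. by []. Qed.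

(** The derivative of the fact that transition maps commute with the projection. It makes chartwise
    pullbacks along pi_2 transform as tensors on the cylinder. *)
Lemma jacobian_transition_cylinder i j (z : 'rV[R]_(1 + m)) :
  @overlap _ _ (cylinder N) i j z ->
  jacobian (@transition _ _ (cylinder N) i j) z *m col_mx 0 1%:M
  = col_mx 0 1%:M *m jacobian (transition i j) (rsubmx z).
Proof.
move=> ijz; have dF := smooth_on_diff (@smooth_on_transition i j)
  (overlap_cylinder ijz).
have dFb : differentiable (@transition _ _ (cylinder N) i j) z.
  exact: (@transition_smooth _ _ (cylinder N) i j [::]).
apply/row_matrixP => k; rewrite !rowE !mulmxA mulmx_col01 mulmx_col01.
rewrite -(deriveEjacobian _ dFb) -(deriveEjacobian _ dF).
rewrite -(derive_rsubmx _ dF).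
have -> : (fun y : 'rV[R]_(1 + m) => transition i j (rsubmx y)) =
    (fun y => rsubmx (@transition _ _ (cylinder N) i j y)).
  by apply/funext => y; rewrite transition_cylinder.
by rewrite (derive_compose _ dFb (differentiable_rsubmx _)) derive_rsubmxE.
Qed.

End Transition.

Theorem proposition6 (R : realType) (n : nat) (N : manifold R (2 * n))
    (J g : matrix_field N) (tau : covector_field N)
    (phi : matrix_field (cylinder N)) :
  kaehler J g ->
  form1 tau ->
  is_exterior_derivative tau (twist g J) ->
  is_lift_phi tau J phi ->
  let omega := twist g J in
  let rho := twist (ricci_tensor g) J in
  let rhobar := twist (ricci_tensor (lift_metric tau g)) phi in
  closed_form2 rhobar /\
  (forall (i : atlas (cylinder N)) (z : 'rV[R]_(1 + 2 * n)), cod i z ->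
     rhobar i z = pi2_pull2 rho i z - 2 *: pi2_pull2 omega i z).
Proof.
move=> kJg ftau dtau Hphi omega rho rhobar.
(* Every remaining claim is transported through this equality from rho - 2 omega on the base; it
   holds on the open set [cod i], hence also for derivatives. *)
have rhobarE (i : atlas N) (z : 'rV[R]_(1 + 2 * n)) : @cod _ _ (cylinder N) i z ->
    rhobar i z = pull2 rsubmx (reduced_form J g i) z.
  by move=> iz; exact: rhobar_chart.
have oU (i : atlas (cylinder N)) : open (cod i) by exact: cod_open.
have smooth_pull (i : atlas N) :
    smooth_on (@cod _ _ (cylinder N) i) (pull2 rsubmx (reduced_form J g i)).
  apply: (@smooth_on_eq _ _ _ (fun z : 'rV[R]_(1 + 2 * n) =>
    col_mx 0 1%:M *m reduced_form J g i (rsubmx z) *m (col_mx 0 1%:M)^T)) => //.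
    by move=> z _; rewrite pull2_rsubmx.
  apply: smooth_on_mulmx => //; last exact: smooth_on_cst.
  apply: smooth_on_mulmx => //; first exact: smooth_on_cst.
  apply: smooth_on_rsubmx; [exact: cod_open|exact: smooth_on_reduced_form].
split; last first.
  move=> i z iz; rewrite rhobarE // /pi2_pull2 !pull2_rsubmx /reduced_form.
  by rewrite mulmxBr mulmxBl -scalemxAr -scalemxAl.
have skew i z u v : cod i z -> bil (rhobar i z) u v = - bil (rhobar i z) v u.
  move=> iz; rewrite rhobarE // pull2_rsubmx !bil_congruence.
  exact: reduced_form_skew.
have smooth_rhobar i : smooth_on (cod i) (rhobar i).
  apply: smooth_on_eq (smooth_pull i) => // z; rewrite inE => iz.
  by rewrite rhobarE.
split; first split; first split.
- exact: smooth_rhobar.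
- move=> i j z ijz; have ijy := overlap_cylinder ijz.
  have jz : cod j (transition i j z) by exact: transition_cod.
  rewrite /pull2 (rhobarE _ _ jz) (rhobarE _ _ ijz.1) !pull2_rsubmx.
  rewrite (reduced_form_transition kJg ijy) /pull2 transition_cylinder.
  apply: bil_inj => u v; rewrite !bil_congruence -!mulmxA.
  by rewrite (jacobian_transition_cylinder ijz).
- by move=> i z iz u v; exact: skew.
move=> i X Y Z sX sY sZ z iz.
rewrite ext_d2_skew; [|exact: smooth_on_diff (smooth_rhobar i) iz
  |exact: smooth_on_diff sX iz|exact: smooth_on_diff sY iz
  |exact: smooth_on_diff sZ iz|by move=> u v; exact: skew].
have dT := smooth_on_diff (smooth_on_reduced_form kJg (i := i)) iz.
(* Derivatives of a tensor pulled back along the projection see only the projected vectors, so the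
   cyclic identity on the base applies. *)
have D u v w : bil ('D_u (rhobar i) z) v w =
    bil ('D_(rsubmx u) (reduced_form J g i) (rsubmx z)) (rsubmx v) (rsubmx w).
  rewrite -(derive_bil_cst _ _ _ (smooth_on_diff (smooth_rhobar i) iz)).
  rewrite -(derive_bil_cst _ _ _ dT).
  have dB : differentiable (fun y => bil (reduced_form J g i y) (rsubmx v)
    (rsubmx w)) (rsubmx z).
    have := smooth_on_bil (rsubmx v) (rsubmx w) (@cod_open _ _ N i)
      (smooth_on_reduced_form kJg (i := i)).
    by move=> s; exact: smooth_on_diff s iz.
  rewrite -(derive_rsubmx u dB); apply: derive_eq_on_open (oU i) iz _ => y iy.
  by rewrite rhobarE // pull2_rsubmx bil_congruence !mulmx_col01.
apply: etrans (congr1 _ _) (mulr0 _).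
apply: etrans (congr2 +%R (congr2 +%R (D _ _ _) (D _ _ _)) (D _ _ _)) _.
exact: derive_reduced_form_cyclic.
Qed.
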